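(* Let $$Z_1(\lambda;\mathbf t)=\sum_{\vec\mu}\mathcal W_{\mu^1,\mu^2,\mu^3}(q)\prod_{i=1}^3(-1)^{|\mu^i|}e^{-|\mu^i|t_i}\,\mathcal W_{(\mu^i)^t}(q),$$ the sum running over all triples $\vec\mu=(\mu^1,\mu^2,\mu^3)$ of partitions, where $q=e^{\sqrt{-1}\lambda}$ and $\mathbf t=(t_1,t_2,t_3)$. Then $$Z_1(\lambda;\mathbf t)=\exp\Big(\sum_{n=1}^\infty\frac{Q_n(\mathbf t)}{-n[n]^2}\Big),$$ where $[n]=q^{n/2}-q^{-n/2}$ and $$Q_n(\mathbf t)=e^{-nt_1}+e^{-nt_2}+e^{-nt_3}-e^{-n(t_1+t_2)}-e^{-n(t_2+t_3)}-e^{-n(t_3+t_1)}+e^{-n(t_1+t_2+t_3)}.$$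
   Context: The identity is one of formal power series in $e^{-t_1},e^{-t_2},e^{-t_3}$ with coefficients functions of $q^{1/2}$. For a partition $\mu$: $|\mu|$ is its size, $\mu^t$ its transpose, $\kappa_\mu=\sum_i\mu_i(\mu_i-2i+1)$. $s_\mu$ are Schur functions and $s_\mu s_\nu=\sum_\rho c^\rho_{\mu\nu}s_\rho$. Define $$\mathcal W_\mu(q)=s_\mu(x_i=q^{-i+\frac12},\ i\ge1),\quad\mathcal W_{\mu/\nu}(q)=\sum_\lambda c^\mu_{\nu\lambda}\mathcal W_\lambda(q),\quad\mathcal W_{\mu\nu}(q)=q^{\kappa_\mu/2+\kappa_\nu/2}\sum_\lambda\mathcal W_{\mu^t/\lambda}(q)\mathcal W_{\nu^t/\lambda}(q)$$ ($\mathcal W_\mu$ identified with the function of $q^{1/2}$ it represents; power sums specialize to $p_n=1/[n]$), and $$\mathcal W_{\mu^1,\mu^2,\mu^3}(q)=q^{\kappa_{\mu^2}/2+\kappa_{\mu^3}/2}\sum_{\rho,\rho^1,\rho^3}c^{\mu^1}_{\rho\rho^1}c^{(\mu^3)^t}_{\rho\rho^3}\frac{\mathcal W_{(\mu^2)^t\rho^1}(q)\mathcal W_{\mu^2\rho^3}(q)}{\mathcal W_{\mu^2}(q)}.$$ *)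

(* Defs.v *)
From HB Require Import structures.
From mathcomp Require Import all_boot all_order all_algebra.
From mathcomp Require Import mpoly complex.
From mathcomp Require Import reals sequences exp trigo.
From Stdlib Require Import ClassicalEpsilon.

Set Implicit Arguments.
Unset Strict Implicit.
Unset Printing Implicit Defensive.

Import GRing.Theory Num.Theory.
Local Open Scope ring_scope.

(* A partition is the nonincreasing list of its positive parts; |mu| is
   [sumn mu]. *)
Definition is_part (mu : seq nat) : bool := sorted geq mu && (0%N \notin mu).

(* The partitions of n, obtained by stripping the trailing zeros of the
   nonincreasing n-tuples of sum n. *)
Definition partitions (n : nat) : seq (seq nat) :=
  [seq [seq x <- [seq val x | x <- t] | x != 0%N] |
    t : n.-tuple 'I_n.+1 <- enum {: n.-tuple 'I_n.+1} &
    sorted geq [seq val x | x <- t] && (sumn [seq val x | x <- t] == n)].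

Lemma strip_zerosK (s : seq nat) : sorted geq s ->
  s = [seq x <- s | x != 0%N] ++
      nseq (size s - size [seq x <- s | x != 0%N]) 0%N.
Proof.
elim: s => //= x s IHs xs; have /IHs {IHs} := path_sorted xs.
case: x xs => [|x] xs /=; last by rewrite subSS => {1}->.
have geq_trans : transitive geq by move=> a b c ba cb; exact: leq_trans cb ba.
have /all_pred1P s0: all (pred1 0%N) s.
  have /allP s_le0 := order_path_min geq_trans xs.
  by apply/allP=> y /s_le0; rewrite /= leqn0.
by rewrite s0 filter_nseq /= size_nseq subn0.
Qed.

Lemma partitions_uniq n : uniq (partitions n).
Proof.
rewrite map_inj_in_uniq; first exact/filter_uniq/enum_uniq.
move=> t u.
rewrite !mem_filter => /andP[/andP[st _] _] /andP[/andP[su _] _] tu.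
have e : [seq val x | x <- t] = [seq val x | x <- u].
  by rewrite (strip_zerosK st) (strip_zerosK su) tu !size_map !size_tuple.
exact/val_inj/(inj_map val_inj).
Qed.

Lemma mem_partitions n mu :
  (mu \in partitions n) = is_part mu && (sumn mu == n).
Proof.
have sum_nz (s : seq nat) : sumn [seq x <- s | x != 0%N] = sumn s.
  by elim: s => //= -[|x] s /= ->.
have geq_trans : transitive geq by move=> a b c ba cb; exact: leq_trans cb ba.
apply/mapP/idP => [[t] | /andP[/andP[mu_s mu_0] /eqP mu_n]].
  rewrite mem_filter => /andP[/andP[st sumt] _] ->.
  by rewrite /is_part sorted_filter // mem_filter sum_nz.
have le_size : (size mu <= n)%N.
  rewrite -mu_n {mu_n mu_s}; elim: mu mu_0 => //= x s IHs.
  by rewrite inE negb_or eq_sym -lt0n => /andP[x0 /IHs le_s]; rewrite -add1n leq_add.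
have le_parts : all (fun x => x < n.+1)%N mu.
  apply/allP=> x x_mu; rewrite ltnS -mu_n.
  elim: (mu) x_mu => //= y s IHs; rewrite inE => /predU1P[<-|/IHs le_x].
    exact: leq_addr.
  exact: leq_trans le_x (leq_addl _ _).
pose p := mu ++ nseq (n - size mu) 0%N.
have p_lt : all (fun x => x < n.+1)%N p by rewrite all_cat le_parts all_nseq orbT.
have p_val : [seq val x | x <- [seq (inord x : 'I_n.+1) | x <- p]] = p.
  rewrite -map_comp -[RHS]map_id; apply/eq_in_map => x /(allP p_lt) x_lt /=.
  by rewrite inordK.
have p_size : size [seq (inord x : 'I_n.+1) | x <- p] == n.
  by rewrite size_map size_cat size_nseq subnKC.
exists (Tuple p_size); last first.
  rewrite /= p_val filter_cat filter_nseq /= cats0; apply/esym/all_filterP.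
  by apply/allP=> x x_mu; apply: contraNneq mu_0 => <-.
rewrite mem_filter mem_enum /= p_val sumn_cat sumn_nseq mul0n addn0 mu_n eqxx !andbT.
rewrite sorted_pairwise // pairwise_cat -!sorted_pairwise // mu_s /=.
apply/andP; split.
  by apply/allrelP => x y _ /nseqP[-> _].
by elim: (n - size mu)%N => //= -[|k].
Qed.

Definition partitions_upto (n : nat) : seq (seq nat) :=
  flatten [seq partitions k | k <- iota 0 n.+1].

Definition transpose (mu : seq nat) : seq nat :=
  [seq count (fun x => (j < x)%N) mu | j <- iota 0 (head 0%N mu)].

Definition kappa (mu : seq nat) : int :=
  \sum_(i < size mu)
    (nth 0%N mu i)%:Z * ((nth 0%N mu i)%:Z - (2 * i.+1)%:Z + 1).

Section SymmetricFunctions.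

Implicit Types (mu nu rho : seq nat).

Definition alternant (n : nat) (a : nat -> nat) : {mpoly rat[n]} :=
  \det (\matrix_(i < n, j < n) 'X_i ^+ a j).

(* s_mu(x_1, ..., x_n) = a_(mu + delta) / a_delta, for n at least the length
   of mu. *)
Definition schur (n : nat) mu : {fraction {mpoly rat[n]}} :=
  tofrac (alternant n (fun j => nth 0%N mu j + (n - j.+1))%N)
  / tofrac (alternant n (fun j => n - j.+1)%N).

Definition psum (n k : nat) : {mpoly rat[n]} := \sum_(i < n) 'X_i ^+ k.

(* P, whose i-th variable (counted from 0) stands for p_(i+1), expresses s_mu
   as a polynomial in the power sums. *)
Definition is_schur_psum mu (P : {mpoly rat[sumn mu]}) : Prop :=
  forall n : nat, (sumn mu <= n)%N ->
    schur n mu = tofrac (P \mPo [tuple psum n i.+1 | i < sumn mu]).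

(* There is exactly one such P, since the power sums are algebraically
   independent generators of the ring of symmetric functions over rat. *)
Definition schur_psum mu : {mpoly rat[sumn mu]} :=
  epsilon (inhabits 0) (@is_schur_psum mu).

Definition is_LR mu nu (c : seq nat -> rat) : Prop :=
  (forall rho, rho \notin partitions (sumn mu + sumn nu) -> c rho = 0) /\
  (forall n : nat, (sumn mu + sumn nu <= n)%N ->
    schur n mu * schur n nu =
    \sum_(rho <- partitions (sumn mu + sumn nu))
      tofrac (c rho)%:MP * schur n rho).

(* [LR mu nu rho] is c^rho_(mu nu); for partitions mu and nu there is exactly
   one family as in [is_LR], since the Schur functions form a basis. *)
Definition LR mu nu : seq nat -> rat :=
  epsilon (inhabits (fun=> 0)) (is_LR mu nu).

End SymmetricFunctions.

(* Throughout, v stands for q^(1/2); as kappa is even-valued,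
   q^(kappa/2) = v^kappa. *)
Section Vertex.

Variables (K : fieldType) (v : K).
Implicit Types (mu nu rho : seq nat).

Definition qnum (n : nat) : K := v ^+ n - v ^- n.

(* The series s_mu(x_i = q^(-i+1/2)) converges only for |q| > 1. The function
   of q^(1/2) that it represents is obtained from the expansion of s_mu in
   power sums through p_n = \sum_(i >= 1) q^(n(-i+1/2)) = 1/[n]. *)
Definition Wpart mu : K :=
  mmap ratr (fun i : 'I_(sumn mu) => (qnum i.+1)^-1) (schur_psum mu).

(* In this definition and the following ones the sums over all partitions are
   truncated at a size beyond which the summands vanish, because c^rho_(mu nu)
   is zero unless |rho| = |mu| + |nu|. *)
Definition Wskew mu nu : K :=
  \sum_(lam <- partitions_upto (sumn mu)) ratr (LR nu lam mu) * Wpart lam.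

Definition Wpair mu nu : K :=
  v ^ (kappa mu + kappa nu) *
  \sum_(lam <- partitions_upto (sumn mu))
    Wskew (transpose mu) lam * Wskew (transpose nu) lam.

Definition Wtriple mu1 mu2 mu3 : K :=
  v ^ (kappa mu2 + kappa mu3) *
  \sum_(rho <- partitions_upto (sumn mu1))
  \sum_(rho1 <- partitions_upto (sumn mu1))
  \sum_(rho3 <- partitions_upto (sumn mu3))
    ratr (LR rho rho1 mu1) * ratr (LR rho rho3 (transpose mu3)) *
    (Wpair (transpose mu2) rho1 * Wpair mu2 rho3 / Wpart mu2).

End Vertex.

(* Formal power series in n variables, as families of coefficients. *)
Section PowerSeries.

Variables (K : fieldType) (n : nat).
Implicit Types (f g : 'X_{1..n} -> K) (m : 'X_{1..n}).

Definition series_mul f g m : K :=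
  \sum_(k : 'X_{1..n < (mdeg m).+1} | (k <= m)%MM) f k * g (m - k)%MM.

Definition series_pow f (k : nat) : 'X_{1..n} -> K :=
  iter k (series_mul f) (fun m => (m == 0%MM)%:R).

(* The exponential of a series f without constant term: f^k then only has
   terms of degree at least k. *)
Definition series_exp f m : K :=
  \sum_(k < (mdeg m).+1) series_pow f k m / (k`!)%:R.

End PowerSeries.

(* The three variables 'X_i stand for e^(-t_(i+1)), i = 0, 1, 2. *)
Section PartitionFunction.

Variables (K : fieldType) (v : K).

Definition i0 : 'I_3 := @Ordinal 3 0 isT.
Definition i1 : 'I_3 := @Ordinal 3 1 isT.
Definition i2 : 'I_3 := @Ordinal 3 2 isT.

(* The coefficient of Z_1 at m collects the triples of partitions of sizes
   m_0, m_1 and m_2. *)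
Definition Z1 (m : 'X_{1..3}) : K :=
  \sum_(mu1 <- partitions (m i0))
  \sum_(mu2 <- partitions (m i1))
  \sum_(mu3 <- partitions (m i2))
    Wtriple v mu1 mu2 mu3 *
    (((-1) ^+ sumn mu1 * Wpart v (transpose mu1)) *
     ((-1) ^+ sumn mu2 * Wpart v (transpose mu2)) *
     ((-1) ^+ sumn mu3 * Wpart v (transpose mu3))).

Definition Qpoly (n : nat) : {mpoly K[3]} :=
  'X_i0 ^+ n + 'X_i1 ^+ n + 'X_i2 ^+ n
  - 'X_i0 ^+ n * 'X_i1 ^+ n - 'X_i1 ^+ n * 'X_i2 ^+ n
  - 'X_i2 ^+ n * 'X_i0 ^+ n
  + 'X_i0 ^+ n * 'X_i1 ^+ n * 'X_i2 ^+ n.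

(* \sum_(n >= 1) Q_n / (- n [n]^2); the n-th summand has no monomial of degree
   less than n. *)
Definition Qseries (m : 'X_{1..3}) : K :=
  \sum_(1 <= n < (mdeg m).+1) (Qpoly n)@_m / (- (n%:R * qnum v n ^+ 2)).

End PartitionFunction.

Definition cexp (R : realType) (z : R[i]) : R[i] :=
  ((expR (complex.Re z) * cos (complex.Im z))
    +i* (expR (complex.Re z) * sin (complex.Im z)))%C.

(* q = e^(i lambda) and q^(1/2) = e^(i lambda / 2). *)
Definition qval (R : realType) (lambda : R[i]) : R[i] := cexp ('i%C * lambda).
Definition qhalf (R : realType) (lambda : R[i]) : R[i] :=
  cexp ('i%C * lambda / 2).

Lemma qhalf_sqr (R : realType) (lambda : R[i]) :
  qhalf lambda ^+ 2 = qval lambda.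
Proof.
case: lambda => a b; rewrite /qhalf /qval.
have h (z : R[i]) : cexp (z / 2) ^+ 2 = cexp z.
  rewrite -[in RHS](divfK (_ : 2 != 0) z) ?pnatr_eq0 // mulr_natr mulr2n.
  case: (z / 2) => x y; rewrite /cexp expr2; simpc => /=.
  rewrite expRD cosD sinD !mulrBr !mulrDr; congr (_ +i* _)%C.
    by congr (_ - _); rewrite mulrACA.
  by rewrite addrC; congr (_ + _); rewrite mulrACA // (mulrC (cos _)).
by rewrite h.
Qed.

(* Main.v *)
(* With w_n = 1/[n], W_mu is the Schur function s_mu at p_n = w_n, and the product
   formula for s_mu at this point gives W_mu = q^(kappa_mu/2) W_(mu^t), which is
   not zero.  Expanding W_(mu,nu) and W_(mu1,mu2,mu3) and summing over mu1 and mu3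
   first, the Littlewood-Richardson rule (in its transposed form, that is, after
   the involution omega) and the Cauchy identity give, with Q_i = e^(-t_i),
     Z_1 = exp (\sum_n (- Q_1^n - Q_3^n + Q_1^n Q_3^n) / (n [n]^2)) *
       \sum_mu (-Q_2)^|mu| s_mu [w_n (1 - Q_1^n)] s_(mu^t) [w_n (1 - Q_3^n)],
   and the remaining sum is again given by the dual Cauchy identity.

   Over an algebraically closed field of characteristic 0, any values of p_1, ..,
   p_N are the power sums of some x in K^N.  Hence identities between Schur
   polynomials in finitely many variables may be used at p_n = w_n, and no ring of
   symmetric functions is needed. *)
Require Import Defs.
From mathcomp Require Import all_boot all_order all_algebra.
From mathcomp Require Import mpoly complex.
From mathcomp Require Import reals.
From mathcomp Require Import fingroup perm zify ring exp trigo.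
From Stdlib Require ClassicalEpsilon.
Local Open Scope ring_scope.

Set Implicit Arguments.
Unset Strict Implicit.
Unset Printing Implicit Defensive.
Import Order.TTheory GRing.Theory Num.Theory.

(** * Sequences with given power sums *)

(** A specialization of the symmetric functions is treated as a sequence [p] of values of the power
    sums: [hs p] recovers the complete functions by Newton's recursion, and [sf] is the Jacobi-Trudi
    determinant in them. This form makes sense over every ring in which the positive integers are
    units and commutes with ring morphisms, so one function serves over [rat], over the closed field
    and over polynomial rings. The quotients of alternants and the [epsilon] choices in the
    definitions are reduced to it. It also makes the exponential algebraic: [hs p] is the graded
    exponential of the sum of p_n / n, and adding exponents becomes convolution. The shape of the
    answer reflects the splitting of the n-th numerator into Q_1^n + Q_3^n - Q_1^n Q_3^n and Q_2^n
    (1 - Q_1^n)(1 - Q_3^n). The factor q^(kappa/2) is not found by counting cells: it comes from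
    comparing the product formulas at v and 1/v, where w_n changes sign. Infinite sums are
    controlled by order: terms of order at least N do not meet coefficients of degree below N. *)

Section Convolution.

Context (R : comNzRingType).
Implicit Types (f g h : nat -> R) (k N : nat).

Definition conv f g k : R := \sum_(i < k.+1) f i * g (k - i)%N.

Definition seq1 : nat -> R := fun k => (k == 0%N)%:R.

(** Below degree N, convolution is the product of truncated polynomials; [conv] inherits
    commutativity and associativity from [{poly R}] in this way. *)
Definition trunc_poly N f : {poly R} := \poly_(i < N) f i.

Lemma conv_trunc N f g k : (k < N)%N ->
  conv f g k = (trunc_poly N f * trunc_poly N g)`_k.
Proof.
move=> kN; rewrite coefM; apply: eq_bigr => i _.
rewrite !coef_poly (leq_ltn_trans (leq_subr _ _) kN).
by rewrite (leq_ltn_trans (leq_ord i) kN).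
Qed.

Lemma conv_poly (p q : {poly R}) k :
  (p * q)`_k = conv (fun i => p`_i) (fun i => q`_i) k.
Proof. exact: coefM. Qed.

Lemma eq_conv f f' g g' k :
  (forall i, (i <= k)%N -> f i = f' i) -> (forall i, (i <= k)%N -> g i = g' i) ->
  conv f g k = conv f' g' k.
Proof.
move=> ff gg; apply: eq_bigr => i _; rewrite ff ?leq_ord //.
by rewrite gg ?leq_subr.
Qed.

Lemma convC f g k : conv f g k = conv g f k.
Proof. by rewrite !(@conv_trunc k.+1) // mulrC. Qed.

Lemma convA f g h k : conv f (conv g h) k = conv (conv f g) h k.
Proof.
pose T := trunc_poly k.+1.
transitivity (T f * (T g * T h))`_k.
  rewrite coefM; apply: eq_bigr => i _.
  rewrite /T coef_poly ltn_ord; congr (_ * _).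
  by rewrite (@conv_trunc k.+1) // ltnS leq_subr.
rewrite mulrA coefM; apply: eq_bigr => i _.
by rewrite {3}/T coef_poly ltnS leq_subr (@conv_trunc k.+1).
Qed.

Lemma conv0E f g : conv f g 0%N = f 0%N * g 0%N.
Proof. by rewrite /conv big_ord1. Qed.

Lemma convDl f g h k : conv (fun i => f i + g i) h k = conv f h k + conv g h k.
Proof. by rewrite /conv -big_split; apply: eq_bigr => i _; rewrite mulrDl. Qed.

(* [newton p h] says that the generating function of [h] is
   exp (\sum_(n >= 1) p_n T^n / n); the value of [p] at 0 is irrelevant. *)
Definition newton (p h : nat -> R) : Prop :=
  h 0%N = 1 /\
  forall k, k%:R * h k = conv (fun i => p i *+ (i != 0%N)) h k.

(** Multiplying degree k by k is a derivation for convolution, since k = i + (k - i); hence the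
    logarithmic derivatives [p] and [p'] add up. *)
Lemma newtonD p p' h h' : newton p h -> newton p' h' ->
  newton (fun i => p i + p' i) (conv h h').
Proof.
move=> [h0 hE] [h'0 h'E]; split; first by rewrite conv0E h0 h'0 mulr1.
move=> k; pose P := fun i => p i *+ (i != 0%N); pose P' := fun i => p' i *+ (i != 0%N).
have -> : conv (fun i => (p i + p' i) *+ (i != 0%N)) (conv h h') k =
  conv (fun i => P i + P' i) (conv h h') k.
  by apply: eq_conv => // i _; rewrite mulrnDl.
rewrite convDl convA [in X in _ = _ + X](eq_conv (g' := conv h' h) (f' := P')) //; last first.
  by move=> i _; exact: convC.
rewrite convA (convC (conv P' h')) /conv mulr_sumr -big_split.
apply: eq_bigr => i _; rewrite -/(conv P h i) -/(conv P' h' _) -hE -h'E.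
rewrite -{1}(subnKC (leq_ord i)) natrD mulrDl; congr (_ + _); first by rewrite mulrA.
exact: mulrCA.
Qed.

Lemma newton0 p : (forall i, p i = 0) -> newton p seq1.
Proof.
move=> p0; split=> // k; rewrite [RHS]big1; last first.
  by move=> i _; rewrite p0 mul0rn mul0r.
by case: k => [|k]; rewrite ?mul0r // /seq1 mulr0.
Qed.

Lemma newton_scale c p h : newton p h ->
  newton (fun i => c ^+ i * p i) (fun i => c ^+ i * h i).
Proof.
case=> h0 hE; split=> [|k]; first by rewrite h0 mulr1.
rewrite /= mulrCA hE mulr_sumr; apply: eq_bigr => i _.
by rewrite -mulrnAr mulrACA -exprD (subnKC (leq_ord i)).
Qed.

Lemma newton_geom c : newton (fun i => c ^+ i) (fun i => c ^+ i).
Proof.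
split=> [|k]; first by rewrite expr0.
rewrite /conv big_ord_recl mulr0n mul0r add0r.
transitivity (\sum_(i < k) c ^+ k); first by rewrite sumr_const card_ord mulr_natl.
apply: eq_bigr => i _; rewrite mulr1n -exprD; congr (c ^+ _).
exact/esym/(subnKC (ltn_ord i)).
Qed.

(** One letter [c] counted negatively: the generating function is the inverse of 1/(1 - cT). *)
Lemma newton_linear c : newton (fun i => - c ^+ i) (fun i => (1 - c *: 'X : {poly R})`_i).
Proof.
split=> [|k]; first by rewrite coefB coef1 coefZ coefX mulr0 subr0.
have cE i : (1 - c *: 'X : {poly R})`_i = (i == 0%N)%:R - c * (i == 1%N)%:R.
  by rewrite coefB coef1 coefZ coefX.
rewrite cE; case: k => [|k]; first by rewrite /conv big_ord1 !mul0r.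
rewrite /conv big_ord_recr big_ord_recl /= subnn !cE mul0r add0r.
case: k => [|k].
  by rewrite big_ord0 /= !(mulr0, mulr1, subr0, add0r, mul1r, mulr1n, expr1).
rewrite big_ord_recr big1 /= => [|i _]; last first.
  rewrite cE /bump /= !add1n !subSS.
  have: (1 < k.+1 - i)%N by rewrite ltn_subRL addn1 ltnS.
  by case: (k.+1 - i)%N => // -[|j] // _; rewrite mulr0 subr0 mulr0.
rewrite /bump /= add1n !subSS subSnn cE /= !(mulr0, mulr1, subr0, add0r, mulr1n, sub0r).
by rewrite oppr0 mulr0 mulrNN -exprSr subrr.
Qed.

End Convolution.

Section NewtonUnique.

Context (R : comUnitRingType).
Implicit Types (p h : nat -> R).
Hypothesis natU : forall k, k.+1%:R \is a @GRing.unit R.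

(** Newton's recursion uses all earlier values, so the structural recursion carries the whole list
    h_0, ..., h_k. *)
Fixpoint hs_rec (p : nat -> R) (k : nat) : seq R :=
  if k is k'.+1 then
    let s := hs_rec p k' in
    rcons s (k%:R^-1 * \sum_(i < k) p i.+1 * s`_(k' - i))
  else [:: 1].

(* The complete homogeneous symmetric function of degree k, as a function of
   the power sums p. *)
Definition hs p k : R := (hs_rec p k)`_k.

Arguments hs : simpl never.

Lemma size_hs_rec p k : size (hs_rec p k) = k.+1.
Proof. by elim: k => //= k IH; rewrite size_rcons IH. Qed.

Lemma nth_hs_rec p k i : (i <= k)%N -> (hs_rec p k)`_i = hs p i.
Proof.
elim: k => [|k IH]; first by rewrite leqn0 => /eqP->.
rewrite leq_eqVlt => /predU1P[->//|]; rewrite ltnS => ik.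
by rewrite /= nth_rcons size_hs_rec ltnS ik IH.
Qed.

Lemma hs0 p : hs p 0 = 1. Proof. by []. Qed.

Lemma hsS p k : hs p k.+1 = k.+1%:R^-1 * \sum_(i < k.+1) p i.+1 * hs p (k - i).
Proof.
rewrite /hs /= nth_rcons size_hs_rec ltnn eqxx; congr (_ * _).
by apply: eq_bigr => i _; rewrite nth_hs_rec // leq_subr.
Qed.

Lemma conv_newton_rec p h k :
  conv (fun i => p i *+ (i != 0%N)) h k.+1 = \sum_(i < k.+1) p i.+1 * h (k - i)%N.
Proof.
rewrite /conv big_ord_recl mul0r add0r; apply: eq_bigr => i _.
by rewrite lift0 subSS.
Qed.

Lemma newton_hs p : newton p (hs p).
Proof.
split=> // -[|k]; first by rewrite /conv big_ord1 !mul0r.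
by rewrite hsS mulrA divrr // mul1r conv_newton_rec.
Qed.

(** The bound [n] matters: finitely many variables realize prescribed power sums only up to some
    degree, and complete functions are compared up to that degree. *)
Lemma newton_uniq p p' h h' n : newton p h -> newton p' h' ->
  (forall i, (0 < i <= n)%N -> p i = p' i) ->
  forall k, (k <= n)%N -> h k = h' k.
Proof.
move=> [h0 hE] [h'0 h'E] pp; elim/ltn_ind=> -[|k] IH kn; first by rewrite h0 h'0.
apply: (mulrI (natU k)); rewrite hE h'E !conv_newton_rec; apply: eq_bigr => i _.
rewrite pp; last by rewrite (leq_trans _ kn).
by rewrite IH ?ltnS ?leq_subr // (leq_trans _ (ltnW kn)) ?leq_subr.
Qed.

Lemma newton_hsE p h : newton p h -> h =1 hs p.
Proof.
by move=> ph k; apply: (newton_uniq ph (newton_hs p) (n := k)).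
Qed.

Lemma eq_hs p p' n : (forall i, (0 < i <= n)%N -> p i = p' i) ->
  forall k, (k <= n)%N -> hs p k = hs p' k.
Proof. exact/newton_uniq/newton_hs/newton_hs. Qed.

Lemma hsD p p' k : hs (fun i => p i + p' i) k = conv (hs p) (hs p') k.
Proof. by rewrite -(newton_hsE (newtonD (newton_hs p) (newton_hs p'))). Qed.

Lemma hs_scale c p k : hs (fun i => c ^+ i * p i) k = c ^+ k * hs p k.
Proof. by rewrite -(newton_hsE (newton_scale c (newton_hs p))). Qed.

Lemma hs_null p k : (forall i, p i = 0) -> hs p k = seq1 R k.
Proof. by move=> p0; rewrite -(newton_hsE (newton0 p0)). Qed.

Lemma conv_hsN p k : conv (hs p) (hs (fun i => - p i)) k = seq1 R k.
Proof. by rewrite -hsD hs_null // => i; rewrite subrr. Qed.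

(** In degree k the recursion contains p_k only in the term p_k h_0 with h_0 = 1, so it can be
    solved for p_k. *)
Lemma newton_psum p p' h h' n : newton p h -> newton p' h' ->
  (forall i, (i <= n)%N -> h i = h' i) ->
  forall k, (0 < k <= n)%N -> p k = p' k.
Proof.
move=> [h0 hE] [h'0 h'E] hh k; elim/ltn_ind: k => -[//|k] IH /andP[_ kn].
have := hE k.+1; rewrite hh // h'E !conv_newton_rec !big_ord_recr /= !subnn h0 h'0.
rewrite !mulr1 => /esym; rewrite (eq_bigr (fun i : 'I_k => p' i.+1 * h' (k - i)%N)).
  by move/addrI.
move=> i _; rewrite IH ?ltnS //; last by rewrite (leq_trans _ (ltnW kn)).
by rewrite hh // (leq_trans (leq_subr _ _)) // ltnW.
Qed.

End NewtonUnique.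

Arguments hs : simpl never.

Lemma newton_morph (R S : comNzRingType) (phi : {rmorphism R -> S}) p h :
  newton p h -> newton (phi \o p) (phi \o h).
Proof.
case=> h0 hE; split=> [|k]; first by rewrite /= h0 rmorph1.
rewrite /= -(rmorph_nat phi) -rmorphM hE rmorph_sum; apply: eq_bigr => i _.
by rewrite rmorphM rmorphMn.
Qed.

(** * Jacobi-Trudi determinants *)

Section JacobiTrudi.

Definition beta (n : nat) (mu : seq nat) (i : nat) : nat :=
  (nth 0%N mu i + (n - i.+1))%N.

Lemma sumn_nth (n : nat) (mu : seq nat) : (size mu <= n)%N ->
  (\sum_(i < n) nth 0 mu i)%N = sumn mu.
Proof.
move=> mun; rewrite sumnE (big_nth 0%N) big_mkord (big_ord_widen n (nth 0%N mu) mun).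
rewrite [RHS]big_mkcond; apply: eq_bigr => i _; case: ltnP => // ?.
by rewrite nth_default.
Qed.

Lemma betaS n mu i : (i < n)%N -> beta n.+1 mu i = (beta n mu i).+1.
Proof. by move=> lt_in; rewrite /beta -addnS -subSn. Qed.

Context (R : comNzRingType).
Implicit Types (h : nat -> R) (mu : seq nat).

(** The test encodes h_k = 0 for k < 0, which truncated subtraction would turn into h_0. *)
Definition toeplitz h (a c : nat) : R := if (c <= a)%N then h (a - c)%N else 0.

Lemma toeplitzS h a c : toeplitz h a.+1 c.+1 = toeplitz h a c.
Proof. by rewrite /toeplitz ltnS subSS. Qed.

Definition jt_minor n h (a : nat -> nat) : R :=
  \det (\matrix_(i < n, j < n) toeplitz h (a i) (n - j.+1)).

(* The Jacobi-Trudi determinant det (h_(mu_i - i + j)): row i stands for the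
   exponent mu_i + n - i and column j for n - j, as in the bialternant. *)
Definition jt n h mu : R := jt_minor n h (beta n mu).

Definition sf h mu : R := jt (size mu) h mu.

Lemma jt_leibniz n h mu :
  jt n h mu = \sum_(s : 'S_n) (-1) ^+ s *
    \prod_(i < n) toeplitz h (beta n mu i) (n - (s i).+1).
Proof.
apply: eq_bigr => s _; congr (_ * _).
by apply: eq_bigr => i _; rewrite mxE.
Qed.

(** The staircase n - i - 1 cancels between rows and columns under any permutation, so each Leibniz
    term without negative indices has total degree |mu|. Truncation, scaling and homogeneity of
    Jacobi-Trudi determinants rest on this. *)
Lemma sum_beta_sub n mu (s : 'S_n) : (size mu <= n)%N ->
  (forall i, (n - (s i).+1 <= beta n mu i)%N) ->
  (\sum_(i < n) (beta n mu i - (n - (s i).+1)))%N = sumn mu.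
Proof.
move=> mun le_s; rewrite sumnB => [|i _]; last exact: le_s.
rewrite big_split /= (sumn_nth mun) [X in (_ + X - _)%N](reindex_perm s).
by rewrite addnK.
Qed.

Lemma jt_congr n h h' mu : (size mu <= n)%N ->
  (forall k, (k <= sumn mu)%N -> h k = h' k) -> jt n h mu = jt n h' mu.
Proof.
move=> mun hh; rewrite !jt_leibniz; apply: eq_bigr => s _; congr (_ * _).
(* A term with a negative index vanishes on both sides; in any other term the indices add up to
   |mu|, so none exceeds it. *)
case: (pickP (fun i : 'I_n => beta n mu i < n - (s i).+1)%N) => [i|le_s].
  move=> lt_i; rewrite (bigD1 i) // [RHS](bigD1 i) //= /toeplitz leqNgt lt_i /=.
  by rewrite !mul0r.
have {}le_s (i : 'I_n) : (n - (s i).+1 <= beta n mu i)%N by rewrite leqNgt [(_ < _)%N]le_s.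
apply: eq_bigr => i _; rewrite /toeplitz le_s hh //.
by rewrite -(sum_beta_sub mun le_s) (bigD1 i) //= leq_addr.
Qed.

Lemma jt_scale n c h mu : (size mu <= n)%N ->
  jt n (fun k => c ^+ k * h k) mu = c ^+ sumn mu * jt n h mu.
Proof.
move=> mun; rewrite !jt_leibniz mulr_sumr; apply: eq_bigr => s _.
rewrite mulrCA; congr (_ * _).
case: (pickP (fun i : 'I_n => beta n mu i < n - (s i).+1)%N) => [i|le_s].
  move=> lt_i; rewrite (bigD1 i) // [in RHS](bigD1 i) //= /toeplitz leqNgt lt_i /=.
  by rewrite !mul0r mulr0.
have {}le_s (i : 'I_n) : (n - (s i).+1 <= beta n mu i)%N by rewrite leqNgt [(_ < _)%N]le_s.
rewrite -(sum_beta_sub mun le_s) expr_sum -big_split.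
by apply: eq_bigr => i _; rewrite /toeplitz le_s.
Qed.

(** A further zero part adds a last row (0, ..., 0, 1); in the minor left by expanding along it, row
    and column exponents are both one too large, which their difference does not see. *)
Lemma jtS n h mu : h 0%N = 1 -> (size mu <= n)%N -> jt n.+1 h mu = jt n h mu.
Proof.
move=> h0 mun; rewrite /jt /jt_minor (expand_det_row _ ord_max) (bigD1 ord_max) //=.
rewrite big1 => [|j jn]; last first.
  rewrite mxE /toeplitz /beta nth_default // subnn addn0.
  have jn' : (j < n)%N by rewrite ltn_neqAle -ltnS ltn_ord andbT.
  by rewrite subSS leqn0 subn_eq0 leqNgt jn' mul0r.
have last1 : toeplitz h (beta n.+1 mu n) (n.+1 - n.+1) = 1.
  by rewrite /toeplitz /beta nth_default // subnn.
rewrite addr0 mxE last1 mul1r /cofactor /=.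
rewrite addnn -mul2n exprM sqrrN expr1n expr1n mul1r; congr (\det _).
apply/matrixP=> i j; rewrite !mxE !lift_max betaS // -(toeplitzS h (beta n mu i)).
by rewrite -[in RHS]subSn.
Qed.

Lemma jt_sf n h mu : h 0%N = 1 -> (size mu <= n)%N -> jt n h mu = sf h mu.
Proof.
move=> h0 /subnK <-; elim: (n - size mu)%N => // k IH.
by rewrite addSn jtS ?leq_addl.
Qed.

Lemma eq_sf h h' mu :
  (forall k, (k <= sumn mu)%N -> h k = h' k) -> sf h mu = sf h' mu.
Proof. exact: jt_congr. Qed.

Lemma sf_scale c h mu : sf (fun k => c ^+ k * h k) mu = c ^+ sumn mu * sf h mu.
Proof. exact: jt_scale. Qed.

(** Let E_i be the product of the 1 - x_j T with j <> i. As [h] inverts the full product, h E_i =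
    1/(1 - x_i T), whose coefficients are the powers of x_i. Up to transposition, the matrix of
    powers is thus a Toeplitz matrix in [h] times a matrix [M] of coefficients of the E_i, and [M]
    does not depend on [a]. *)
Lemma bialternant n (x : 'I_n -> R) h (a : nat -> nat) :
  (forall k, conv h (fun i => (\prod_j (1 - x j *: 'X : {poly R}))`_i) k = seq1 R k) ->
  \det (\matrix_(i < n, j < n) x i ^+ a j) =
  jt_minor n h a * \det (\matrix_(i < n, j < n) x i ^+ (n - j.+1)).
Proof.
move=> hx; pose E (i : 'I_n) : {poly R} := \prod_(j | j != i) (1 - x j *: 'X).
have sizeE i : (size (E i) <= n)%N.
  have size1 j : (size (1 - x j *: 'X : {poly R})%R <= 2)%N.
    rewrite (leq_trans (size_polyD _ _)) // geq_max size_poly1 size_polyN /=.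
    by rewrite (leq_trans (size_scale_leq _ _)) // size_polyX.
  rewrite (leq_trans (size_prod_leq _ _)) //.
  apply: leq_trans (_ : ((\sum_(j | j != i) 2).+1 - #|[pred j | j != i]| <= n)%N).
    by apply: leq_sub2r; rewrite ltnS; apply: leq_sum.
  have cardE : #|[pred j | j != i]| = n.-1.
    by have := cardC1 i; rewrite card_ord.
  rewrite sum_nat_const cardE muln2 -addnn -addnS addKn.
  by rewrite prednK ?(leq_ltn_trans _ (ltn_ord i)).
have geom i k : conv h (fun r => (E i)`_r) k = x i ^+ k.
  have step k' : conv h (fun r => (E i)`_r) k'.+1 = x i * conv h (fun r => (E i)`_r) k'.
    have := hx k'.+1; rewrite (bigD1 i) //= -/(E i) /seq1 /=.
    rewrite mulr0n => hk; apply/eqP; rewrite -subr_eq0 -[X in _ == X]hk.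
    rewrite /conv mulr_sumr !(big_ord_recr k'.+1) /= subnn.
    rewrite mulrBl mul1r coefB -scalerAl coefZ coefXM mulr0 subr0 addrAC -sumrB.
    rewrite (inj_eq (addIr _)); apply/eqP/eq_bigr => r _.
    by rewrite coefB coefZ coefXM subSn ?leq_ord //= mulrBr mulrCA.
  elim: k => [|k IH]; last by rewrite step IH exprS.
  have := hx 0%N; rewrite !conv0E (bigD1 i) //= -/(E i) mulrBl mul1r -scalerAl.
  by rewrite coefB coefZ coefXM mulr0 subr0 => ->.
pose M := \matrix_(i < n, j < n) (E j)`_(n - i.+1).
have detE (b : nat -> nat) : \det (\matrix_(i < n, j < n) x i ^+ b j) = jt_minor n h b * \det M.
  rewrite -det_mulmx -[LHS]det_tr; congr (\det _); apply/matrixP=> i j.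
  rewrite !mxE -geom; under eq_bigr do rewrite !mxE.
  have revK (r : 'I_n) : (n - (rev_ord r).+1)%N = r := congr1 val (rev_ordK r).
  rewrite (reindex_inj rev_ord_inj); under eq_bigr => r _ do rewrite revK.
  rewrite convC /conv.
  have [ltbn|lenb] := ltnP (b i).+1 n.
    rewrite (big_ord_widen n (fun r => (E j)`_r * h (b i - r)%N)) 1?ltnW //.
    rewrite big_mkcond; apply: eq_bigr => r _; rewrite /toeplitz ltnS.
    by case: ifP => _; rewrite ?mul0r // mulrC.
  rewrite [RHS](big_ord_widen _ (fun r => toeplitz h (b i) r * (E j)`_r) lenb).
  rewrite [RHS]big_mkcond; apply: eq_bigr => r _; rewrite /toeplitz leq_ord.
  case: ltnP => [_|nr]; first by rewrite mulrC.
  by rewrite nth_default ?mul0r // (leq_trans (sizeE j)).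
rewrite detE; congr (_ * _).
(* For the staircase exponents the Toeplitz matrix is unitriangular, so [\det M] is the Vandermonde
   determinant. *)
rewrite (detE (fun j => n - j.+1)%N); suff ->: jt_minor n h (fun j => n - j.+1)%N = 1.
  by rewrite mul1r.
have h0 : h 0%N = 1.
  have := hx 0%N; rewrite conv0E -horner_coef0 horner_prod big1 ?mulr1 // => j _.
  by rewrite hornerD hornerN hornerZ hornerX hornerC mulr0 subr0.
rewrite /jt_minor -det_tr det_trig; last first.
  apply/is_trig_mxP=> i j ij; rewrite !mxE /toeplitz leqNgt.
  by rewrite ltn_sub2l ?ltnS // (leq_ltn_trans ij).
by rewrite big1 // => i _; rewrite !mxE /toeplitz leqnn subnn h0.
Qed.

End JacobiTrudi.

Lemma jt_morph (R S : comNzRingType) (phi : {rmorphism R -> S}) n h mu :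
  phi (jt n h mu) = jt n (phi \o h) mu.
Proof.
rewrite -det_map_mx; congr (\det _); apply/matrixP=> i j; rewrite !mxE /toeplitz.
by case: ifP => _; rewrite ?rmorph0.
Qed.

Lemma sf_morph (R S : comNzRingType) (phi : {rmorphism R -> S}) h mu :
  phi (sf h mu) = sf (phi \o h) mu.
Proof. exact: jt_morph. Qed.

(** * Alternating polynomials *)

Section PowerSums.

Lemma eq_newton (R : comNzRingType) (p p' h h' : nat -> R) :
  p =1 p' -> h =1 h' -> newton p h -> newton p' h'.
Proof.
move=> pp hh [h0 hE]; split=> [|k]; rewrite -hh //.
by rewrite hE; apply: eq_conv => i _ //; rewrite pp.
Qed.

Lemma newton_prod_linear (R : comNzRingType) (I : Type) (s : seq I) (x : I -> R) :
  newton (fun k => - \sum_(i <- s) x i ^+ k)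
    (fun k => (\prod_(i <- s) (1 - x i *: 'X : {poly R}))`_k).
Proof.
elim: s => [|i s IH].
  apply: eq_newton (newton0 (p := fun=> 0) _) => // k.
    by rewrite big_nil oppr0.
  by rewrite big_nil coef1.
apply: eq_newton (newtonD (newton_linear (x i)) IH) => k.
  by rewrite big_cons opprD.
by rewrite big_cons -conv_poly.
Qed.

Lemma conv_hs_prod_linear (R : comUnitRingType)
    (natU : forall k, k.+1%:R \is a @GRing.unit R) n (x : 'I_n -> R) k :
  conv (hs (fun k => \sum_i x i ^+ k))
    (fun i => (\prod_j (1 - x j *: 'X : {poly R}))`_i) k = seq1 R k.
Proof.
rewrite -(conv_hsN natU (fun k => \sum_i x i ^+ k)); apply: eq_conv => // i _.
exact/(newton_hsE natU)/newton_prod_linear.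
Qed.

Lemma coef_prod_linear_rev (R : comNzRingType) (s : seq R) r : (r <= size s)%N ->
  (\prod_(x <- s) ('X - x%:P))`_(size s - r) = (\prod_(x <- s) (1 - x *: 'X : {poly R}))`_r.
Proof.
have sz (t : seq R) : (size (\prod_(x <- t) (1 - x *: 'X : {poly R}))%R <= (size t).+1)%N.
  elim: t => [|x t IH]; first by rewrite big_nil size_poly1.
  rewrite big_cons mulrBl mul1r -scalerAl (leq_trans (size_polyD _ _)) // geq_max.
  rewrite (leq_trans IH) // size_polyN (leq_trans (size_scale_leq _ _)) //.
  by rewrite (leq_trans (size_polyMleq _ _)) // size_polyX.
elim: s r => [|x s IH] r /=; first by rewrite leqn0 => /eqP->; rewrite !big_nil.
rewrite !big_cons !mulrBl mul1r -scalerAl !coefB coefXM coefCM coefZ coefXM.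
case: r => [|r] rs.
  rewrite subn0 /= mulr0 -(IH 0%N) // subn0; congr (_ - _).
  by rewrite nth_default ?mulr0 // size_prod_XsubC.
rewrite subSS subn_eq0 -(IH r) //=; congr (_ - _).
case: ltnP => rs'; last first.
  by rewrite nth_default // (leq_trans (sz s)).
by rewrite -(IH r.+1) // subnS.
Qed.

(** The signed elementary functions belonging to [p] are the coefficients of a monic polynomial of
    degree n; its roots are the required x. *)
Lemma exists_psum (K : closedFieldType)
    (natU : forall k, k.+1%:R \is a @GRing.unit K) (p : nat -> K) n :
  exists x : 'I_n -> K, forall k, (0 < k <= n)%N -> \sum_i x i ^+ k = p k.
Proof.
pose e := hs (fun k => - p k).
pose P : {poly K} := \poly_(i < n.+1) e (n - i)%N.
have size_P : size P = n.+1 by rewrite size_poly_eq // subnn oner_neq0.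
have monP : P \is monic by rewrite monicE lead_coefE size_P coef_poly ltnSn subnn.
have [s Ps] := closed_field_poly_normal P.
rewrite (eqP monP) scale1r in Ps.
have size_s : size s = n.
  by have := size_P; rewrite Ps size_prod_XsubC => -[].
have es k : (k <= n)%N -> e k = (\prod_(x <- s) (1 - x *: 'X : {poly K}))`_k.
  move=> kn; rewrite -coef_prod_linear_rev ?size_s // -Ps coef_poly ltnS leq_subr.
  by rewrite subKn.
exists (fun i => s`_i) => k kn; apply: oppr_inj.
have := newton_psum (newton_hs natU (fun k => - p k)) (newton_prod_linear s id) es kn.
by move=> ->; rewrite (big_nth 0) size_s big_mkord.
Qed.

End PowerSums.

Section Alternants.

Context (F : fieldType) (natF : forall k, k.+1%:R != 0 :> F).

Definition alt n (a : nat -> nat) : {mpoly F[n]} :=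
  \det (\matrix_(i < n, j < n) 'X_i ^+ a j).

Definition pws n (k : nat) : {mpoly F[n]} := \sum_(i < n) 'X_i ^+ k.

Definition mnm_of n (a : nat -> nat) : 'X_{1..n} := [multinom a i | i < n].

Lemma natU_mpoly n k : k.+1%:R \is a @GRing.unit {mpoly F[n]}.
Proof. by rewrite -mpolyC_nat rmorph_unit // unitfE natF. Qed.

Lemma alt_jt n mu :
  alt n (beta n mu) = jt n (hs (pws n)) mu * alt n (fun j => n - j.+1)%N.
Proof.
apply: (@bialternant _ n (fun i => 'X_i)) => k.
exact: (conv_hs_prod_linear (@natU_mpoly n)).
Qed.

Lemma altE n a :
  alt n a = \sum_(s : 'S_n) (-1) ^+ s *: 'X_[[multinom a (s i) | i < n]].
Proof.
rewrite /alt /determinant; apply: eq_bigr => s _; rewrite -[RHS]mul_mpolyC rmorphXn rmorphN1;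
  congr (_ * _).
by rewrite mpolyXE_id; apply: eq_bigr => i _; rewrite mxE mnmE.
Qed.

Definition strict n (m : nat -> nat) := forall i j, (i < j < n)%N -> (m j < m i)%N.

(** Such an [s] is increasing, hence i <= s i for all i; the differences s i - i add up to 0, so all
    of them vanish. *)
Lemma strict_perm1 n a b (s : 'S_n) : strict n a -> strict n b ->
  (forall i : 'I_n, a (s i) = b i) -> s = 1%g.
Proof.
move=> sa sb ab.
have mono (i j : 'I_n) : (i < j)%N -> (s i < s j)%N.
  move=> ij; have := sb i j; rewrite ij ltn_ord -!ab => /(_ isT).
  case: (ltngtP (s i) (s j)) => // [lt_s|/val_inj->]; last by rewrite ltnn.
  by have := sa _ _ (introT andP (conj lt_s (ltn_ord (s i)))); case: ltngtP.
have le_s (i : 'I_n) : (i <= s i)%N.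
  case: i => i; elim: i => // i IH lt_in /=.
  exact: leq_ltn_trans (IH (ltnW lt_in)) (mono (Ordinal (ltnW lt_in)) (Ordinal lt_in)
    (ltnSn i)).
have sumE : (\sum_i (s i - i) = 0)%N.
  rewrite sumnB => [|i _]; last exact: le_s.
  by rewrite [X in (_ - X)%N](reindex_perm s) subnn.
apply/permP=> i; rewrite perm1; apply/val_inj/eqP; rewrite eqn_leq le_s andbT.
move/eqP: sumE; rewrite sum_nat_eq0 => /forallP/(_ i) /=.
by rewrite subn_eq0.
Qed.

(** An alternant has one monomial per permutation, and only the identity gives decreasing exponents.
    Coefficients at decreasing exponents therefore separate alternants. *)
Lemma mcoeff_alt n a b : strict n a -> strict n b ->
  (alt n a)@_(mnm_of n b) = (mnm_of n a == mnm_of n b)%:R.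
Proof.
move=> sa sb; rewrite altE raddf_sum /= (bigD1 1%g) //= big1 => [|s s1].
  rewrite odd_perm1 scale1r addr0 mcoeffX; congr ((_ == _)%:R).
  by apply/mnmP=> i; rewrite !mnmE perm1.
rewrite mcoeffZ mcoeffX; case: eqP => [/mnmP ab|]; last by rewrite mulr0.
case/eqP: s1; apply: (strict_perm1 sa sb) => i.
by have := ab i; rewrite !mnmE.
Qed.

Lemma strict_beta n mu : sorted geq mu -> strict n (beta n mu).
Proof.
move=> mu_s i j /andP[ij jn]; rewrite /beta -addnS leq_add //; last first.
  by apply: ltn_sub2l => //; exact: leq_ltn_trans ij jn.
have [js|sj] := ltnP j (size mu); last by rewrite nth_default.
have geq_trans : transitive geq by move=> a b c ba cb; exact: leq_trans cb ba.
exact: (sorted_ltn_nth geq_trans 0%N mu_s i j (ltn_trans ij js) js ij).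
Qed.

Definition antisym n (P : {mpoly F[n]}) := forall s : 'S_n, msym s P = (-1) ^+ s *: P.

Lemma antisym_alt n a : antisym (alt n a).
Proof.
move=> s; rewrite /alt -det_map_mx.
have -> : map_mx (msym s) (\matrix_(i < n, j < n) 'X_i ^+ a j) =
  perm_mx s *m (\matrix_(i < n, j < n) 'X_i ^+ a j : 'M[{mpoly F[n]}]_n).
  rewrite -row_permE; apply/matrixP=> i j; rewrite !mxE rmorphXn /=; congr (_ ^+ _).
  by rewrite /msym mmapX mmap1U.
by rewrite det_mulmx det_perm -mul_mpolyC rmorphXn rmorphN1.
Qed.

Lemma antisymM n (P Q : {mpoly F[n]}) : (forall s, msym s P = P) -> antisym Q ->
  antisym (P * Q).
Proof. by move=> sP aQ s; rewrite msymM sP aQ scalerAr. Qed.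

Lemma antisym_sum n (I : eqType) (r : seq I) (c : I -> F) (P : I -> {mpoly F[n]}) :
  (forall i, antisym (P i)) -> antisym (\sum_(i <- r) c i *: P i).
Proof.
move=> aP s; rewrite raddf_sum scaler_sumr; apply: eq_bigr => i _.
by rewrite /= msymZ aP !scalerA mulrC.
Qed.

(** Sorting the exponents of a monomial changes its coefficient only by a sign, and a repeated
    exponent makes the coefficient equal to its own negative, hence zero as 2 is invertible. *)
Lemma antisym_eq n (P Q : {mpoly F[n]}) : antisym P -> antisym Q ->
  (forall m : 'X_{1..n}, (forall i j : 'I_n, (i < j)%N -> (m j < m i)%N) -> P@_m = Q@_m) ->
  P = Q.
Proof.
move=> aP aQ eqPQ; apply/mpolyP=> m.
have [/injectiveP m_inj|/injectivePn[i [j ij mij]]] := boolP (injectiveb m).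
  have /tuple_permP[s Es] : perm_eq (sort_tuple geq [tuple m i | i < n]) [tuple m i | i < n].
    by rewrite perm_sort.
  have ms (i : 'I_n) : m (s i) = nth 0%N (sort geq [tuple m i | i < n]) i.
    by rewrite -(tnth_nth 0%N (sort_tuple geq [tuple m i | i < n])) (val_inj Es) !tnth_mktuple.
  have geq_trans : transitive geq by move=> a b c ba cb; exact: leq_trans cb ba.
  have geq_total : total geq by move=> a b; exact: leq_total.
  have strict_ms (i j : 'I_n) : (i < j)%N -> (m (s j) < m (s i))%N.
    move=> ij; rewrite ltn_neqAle !ms.
    have := sorted_ltn_nth geq_trans 0%N (sort_sorted geq_total [tuple m i | i < n]) i j.
    rewrite !inE size_sort size_tuple !ltn_ord => /(_ isT isT ij) /= ->.
    rewrite andbT -!ms; apply/eqP => /m_inj/perm_inj/val_eqP; by rewrite /= gtn_eqF.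
  have mE (G : {mpoly F[n]}) : antisym G ->
      G@_m = (-1) ^+ s * G@_[multinom m (s i) | i < n].
    move=> /(_ s) /(congr1 (mcoeff m)); rewrite mcoeff_sym mcoeffZ => ->.
    by rewrite mulrA -expr2 sqrr_sign mul1r.
  rewrite !mE // eqPQ // => i j ij; rewrite !mnmE; exact: strict_ms.
have mt : [multinom m (tperm i j k) | k < n] = m.
  apply/mnmP=> k; rewrite mnmE; case: tpermP => [->|->|//]; by rewrite mij.
have two : 2%:R != 0 :> F := natF 1.
have z (G : {mpoly F[n]}) : antisym G -> G@_m = 0.
  move=> /(_ (tperm i j)) /(congr1 (mcoeff m)).
  rewrite mcoeff_sym mt odd_tperm ij expr1 scaleN1r mcoeffN => /eqP.
  by rewrite -addr_eq0 -mulr2n -mulr_natl mulf_eq0 (negPf two) => /eqP.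
by rewrite !z.
Qed.

End Alternants.

(** * Antisymmetric polynomials as combinations of alternants, and the Cauchy kernel *)

Section Expansion.

Context (F : fieldType) (natF : forall k, k.+1%:R != 0 :> F).

Lemma part_eqP mu nu : is_part mu -> is_part nu ->
  (forall i, nth 0%N mu i = nth 0%N nu i) -> mu = nu.
Proof.
have le_size (a b : seq nat) : 0%N \notin b -> (forall i, nth 0%N a i = nth 0%N b i) ->
    (size b <= size a)%N.
  move=> b0 ab; rewrite leqNgt; apply: contra b0 => lt_ab.
  by have := mem_nth 0%N lt_ab; rewrite -ab nth_default.
move=> /andP[_ mu0] /andP[_ nu0] munu; apply: (@eq_from_nth _ 0%N) => //.
by apply/eqP; rewrite eqn_leq !le_size.
Qed.

Lemma size_part mu : is_part mu -> (size mu <= sumn mu)%N.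
Proof.
case/andP=> _; elim: mu => //= x s IHs.
by rewrite inE negb_or eq_sym -lt0n => /andP[x0 /IHs le_s]; rewrite -add1n leq_add.
Qed.

Lemma partP d mu : mu \in partitions d -> [/\ is_part mu, sumn mu = d & (size mu <= d)%N].
Proof. by rewrite mem_partitions => /andP[mup /eqP <-]; rewrite size_part. Qed.

Lemma mnm_of_beta_inj n mu nu : is_part mu -> is_part nu ->
  (size mu <= n)%N -> (size nu <= n)%N ->
  mnm_of n (beta n mu) = mnm_of n (beta n nu) -> mu = nu.
Proof.
move=> mup nup mun nun /mnmP e; apply: part_eqP => // i.
have [lt_in|le_ni] := ltnP i n; last by rewrite !nth_default // (leq_trans _ le_ni).
by have := e (Ordinal lt_in); rewrite !mnmE /= /beta => /addIn.
Qed.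

Definition deg_delta n := (\sum_(i < n) (n - i.+1))%N.

Lemma mdeg_beta n mu : (size mu <= n)%N ->
  mdeg (mnm_of n (beta n mu)) = (sumn mu + deg_delta n)%N.
Proof.
move=> mun; rewrite mdegE -(sumn_nth mun) -big_split.
by apply: eq_bigr => i _; rewrite mnmE.
Qed.

(** Subtracting the staircase from strictly decreasing exponents leaves a nonincreasing tuple;
    stripping its zeros gives the partition. *)
Lemma strict_partition n d (m : 'X_{1..n}) : (forall i j : 'I_n, (i < j)%N -> (m j < m i)%N) ->
  mdeg m = (d + deg_delta n)%N ->
  exists2 mu, mu \in partitions d & mnm_of n (beta n mu) = m.
Proof.
move=> sm dm; pose a i := nth 0%N m i.
have sa i j : (i < j < n)%N -> (a j < a i)%N.
  move=> /andP[ij jn]; have := sm (Ordinal (ltn_trans ij jn)) (Ordinal jn) ij.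
  by rewrite !(mnm_nth 0%N).
(* In a strictly decreasing tuple, an entry followed by k others is at least k, so subtracting the
   staircase never truncates. *)
have lb k i : (i + k < n)%N -> (k <= a i)%N.
  elim: k i => // k IH i; rewrite addnS -addSn => /[dup] ikn /IH le_k.
  by apply: leq_ltn_trans le_k (sa _ _ _); rewrite ltnSn (leq_ltn_trans (leq_addr k _) ikn).
have le_a (i : 'I_n) : (n - i.+1 <= a i)%N by apply: lb;
  rewrite -ltn_subRL subnS prednK ?subn_gt0.
pose s := mkseq (fun i => a i - (n - i.+1))%N n.
have s_sorted : sorted geq s.
  apply/(sortedP 0%N) => i; rewrite size_mkseq => lt_in.
  rewrite !nth_mkseq ?(ltnW lt_in) //=.
  have := sa i i.+1; rewrite ltnSn lt_in => /(_ isT) aa.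
  by move: (a i) (a i.+1) aa lt_in => x y; lia.
pose mu := [seq x <- s | x != 0%N].
have sE := strip_zerosK s_sorted; rewrite -/mu in sE.
have nth_mu i : nth 0%N mu i = nth 0%N s i.
  rewrite [in RHS]sE nth_cat; case: ltnP => // le_i.
  by rewrite nth_default // nth_nseq if_same.
have sumn_mu : sumn mu = sumn s.
  by rewrite [in RHS]sE sumn_cat sumn_nseq mul0n addn0.
have mp : is_part mu.
  apply/andP; split; last by rewrite mem_filter.
  by apply: sorted_filter => // x y z yx zy; exact: leq_trans zy yx.
exists mu.
  rewrite mem_partitions mp sumn_mu -(@sumn_nth n) ?size_mkseq //=.
  apply/eqP/(@addIn (deg_delta n)); rewrite -dm mdegE -big_split.
  apply: eq_bigr => i _ /=; rewrite nth_mkseq // subnK ?le_a //.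
  by rewrite (mnm_nth 0%N).
apply/mnmP=> i; rewrite mnmE /beta nth_mu nth_mkseq // subnK ?le_a //.
by rewrite (mnm_nth 0%N).
Qed.

(** Each alternant is detected at its only decreasing monomial; d <= n lets every partition of d fit
    into n rows. *)
Lemma antisym_expand n d (P : {mpoly F[n]}) : antisym P ->
  P \is (d + deg_delta n).-homog -> (d <= n)%N ->
  P = \sum_(mu <- partitions d) P@_(mnm_of n (beta n mu)) *: alt F n (beta n mu).
Proof.
move=> aP hP dn; apply: (antisym_eq natF) => // [|m sm].
  by apply: antisym_sum => mu; exact: antisym_alt.
pose a i := nth 0%N m i.
have ma : m = mnm_of n a by apply/mnmP=> i; rewrite mnmE (mnm_nth 0%N).
have sa : strict n a.
  move=> i j /andP[ij jn]; have := sm (Ordinal (ltn_trans ij jn)) (Ordinal jn) ij.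
  by rewrite !(mnm_nth 0%N).
rewrite raddf_sum /= {2}ma.
transitivity (\sum_(mu <- partitions d)
    P@_(mnm_of n (beta n mu)) * (mnm_of n (beta n mu) == m)%:R); last first.
  apply: eq_big_seq => mu /partP[/andP[mus _] _ _].
  by rewrite mcoeffZ mcoeff_alt -?ma //; exact: strict_beta.
have [dm|dm] := eqVneq (mdeg m) (d + deg_delta n)%N.
  have [mu mud muE] := strict_partition sm dm.
  rewrite (bigD1_seq mu) ?partitions_uniq //= muE eqxx mulr1 big_seq_cond big1 ?addr0 //.
  move=> nu /andP[nud nmu]; case: eqP => [nuE|]; last by rewrite mulr0.
  case/eqP: nmu; have [nup _ nus] := partP nud; have [mup _ mus] := partP mud.
  by apply: (@mnm_of_beta_inj n) => //; rewrite ?(leq_trans _ dn) // nuE.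
rewrite (dhomog_nemf_coeff hP dm) big_seq big1 // => mu /partP[_ mud mus].
case: eqP => [mE|]; last by rewrite mulr0.
case/eqP: dm; rewrite -mE.
by rewrite mdeg_beta ?(leq_trans mus) // mud.
Qed.

Lemma alt_free n d (b : seq nat -> F) : (d <= n)%N ->
  \sum_(mu <- partitions d) b mu *: alt F n (beta n mu) = 0 ->
  forall mu, mu \in partitions d -> b mu = 0.
Proof.
move=> dn sum0 mu mud; have [mup _ mus] := partP mud.
have := congr1 (mcoeff (mnm_of n (beta n mu))) sum0.
have /andP[muS _] := mup.
rewrite raddf_sum mcoeff0 (bigD1_seq mu) ?partitions_uniq //= mcoeffZ.
rewrite mcoeff_alt ?eqxx ?mulr1; try exact: strict_beta.
rewrite big_seq_cond big1 ?addr0 // => nu /andP[nud nmu].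
have [nup _ nus] := partP nud; have /andP[nuS _] := nup.
rewrite mcoeffZ mcoeff_alt; try exact: strict_beta.
case: eqP => [nuE|]; last by rewrite mulr0.
case/eqP: nmu; apply: (@mnm_of_beta_inj n) => //; by rewrite ?(leq_trans _ dn).
Qed.

Lemma alt_delta_neq0 n : alt F n (fun j => n - j.+1)%N != 0.
Proof.
have s : strict n (fun j => n - j.+1)%N.
  by move=> i j /andP[ij jn]; apply: ltn_sub2l => //; exact: leq_ltn_trans ij jn.
apply/eqP => /(congr1 (mcoeff (mnm_of n (fun j => n - j.+1)%N))).
by rewrite mcoeff_alt // eqxx mcoeff0 => /eqP; rewrite oner_eq0.
Qed.

Lemma dhomog_pws n k : pws F n k \is k.-homog.
Proof.
by apply: rpred_sum => i _; rewrite mpolyXn dhomogX /= mdegMn mdeg1 mul1n eqxx.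
Qed.

Lemma dhomog_hs n (p : nat -> {mpoly F[n]}) k :
  (forall k, p k \is k.-homog) -> hs p k \is k.-homog.
Proof.
move=> hp; elim/ltn_ind: k => -[|k] IH; first by rewrite hs0 dhomog1.
rewrite hsS -[_%:R]mpolyC_nat -rmorphV ?unitfE ?natF // mul_mpolyC.
apply: rpredZ; apply: rpred_sum => -[i /= lt_ik] _.
have -> : k.+1 = (i.+1 + (k - i))%N by rewrite addSn subnKC.
apply: dhomogM; first exact: hp.
by apply: IH; rewrite ltnS leq_subr.
Qed.

Lemma dhomog_jt n (h : nat -> {mpoly F[n]}) mu : (size mu <= n)%N ->
  (forall k, h k \is k.-homog) -> jt n h mu \is (sumn mu).-homog.
Proof.
move=> mun hh; rewrite jt_leibniz; apply: rpred_sum => s _.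
rewrite -(rmorphN1 (@mpolyC n F)) -rmorphXn mul_mpolyC; apply: rpredZ.
case: (pickP (fun i : 'I_n => beta n mu i < n - (s i).+1)%N) => [i lt_i|le_s].
  by rewrite (bigD1 i) //= /toeplitz leqNgt lt_i mul0r rpred0.
have {}le_s (i : 'I_n) : (n - (s i).+1 <= beta n mu i)%N by rewrite leqNgt [(_ < _)%N]le_s.
rewrite -(sum_beta_sub mun le_s).
elim/big_rec2: _ => [|i d P _ hP]; first exact: dhomog1.
by rewrite /toeplitz le_s; apply: dhomogM.
Qed.

Lemma mcoeff_XM n (c m : 'X_{1..n}) (Q : {mpoly F[n]}) :
  ('X_[c] * Q)@_m = if (c <= m)%MM then Q@_(m - c) else 0.
Proof.
case: ifP => cm; first by rewrite -[in LHS](submK cm) mulrC addmC mcoeffMX.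
rewrite [Q in LHS]mpolyE mulr_sumr raddf_sum big1 //= => k _.
rewrite -scalerAr mcoeffZ -mpolyXD mcoeffX; case: eqP => [ck|]; last by rewrite mulr0.
by rewrite -ck lem_addr in cm.
Qed.

(** Power sums of the product of two alphabets, an abstract one with power sums [p] and the n
    variables; [hs] of them is the Cauchy kernel. *)
Definition pws_scaled n (p : nat -> F) k : {mpoly F[n]} := (p k)%:MP * pws F n k.

Lemma dhomog_pws_scaled n p k : pws_scaled n p k \is k.-homog.
Proof. by rewrite /pws_scaled mul_mpolyC; apply: rpredZ; exact: dhomog_pws. Qed.

Lemma natU_field k : k.+1%:R \is a @GRing.unit F.
Proof. by rewrite unitfE. Qed.

(** The kernel is the product over i of the series with terms h_k(p) x_i^k. The induction multiplies
    the coefficient by d, the sum of the m_i, and uses Newton's identity for [p] in each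
    variable. *)
Lemma mcoeff_hs_pws n p d m :
  (hs (pws_scaled n p) d)@_m = if mdeg m == d then \prod_i hs p (m i) else 0.
Proof.
case: ifP => [|dm]; last first.
  by rewrite (dhomog_nemf_coeff (dhomog_hs _ _)) ?dm // => k; exact: dhomog_pws_scaled.
elim/ltn_ind: d m => -[|d] IH m.
  rewrite mdeg_eq0 => /eqP->; rewrite hs0 mcoeff1 eqxx big1 // => i _.
  by rewrite mnm0E hs0.
move=> /eqP dm; apply: (mulfI (natF d)).
have [_ /(_ d.+1)] := newton_hs (@natU_mpoly _ natF n) (pws_scaled n p).
rewrite conv_newton_rec => /(congr1 (mcoeff m)) hsE.
rewrite mulr_natl mcoeffMn -mulr_natl in hsE; rewrite {}hsE.
rewrite raddf_sum /=.
transitivity (\sum_(k < d.+1) \sum_(i < n) if (k < m i)%N then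
   p k.+1 * hs p (m i - k.+1) * \prod_(j | j != i) hs p (m j) else 0).
  apply: eq_bigr => k _.
  rewrite /pws_scaled mul_mpolyC -scalerAl mcoeffZ mulr_suml raddf_sum mulr_sumr.
  apply: eq_bigr => i _ /=; rewrite mpolyXn mcoeff_XM.
  have -> : (U_(i) *+ k.+1 <= m)%MM = (k < m i)%N.
    apply/mnm_lepP/idP => [/(_ i)|lt_k j]; first by rewrite mulmnE mnm1E eqxx mul1n.
    by rewrite mulmnE mnm1E; case: eqP => [<-|_]; rewrite ?mul1n.
  case: ltnP => lt_k; last by rewrite mulr0.
  rewrite IH ?ltnS ?leq_subr //; last first.
    have le_m : (U_(i) *+ k.+1 <= m)%MM.
      by apply/mnm_lepP => j; rewrite mulmnE mnm1E; case: eqP => [<-|_]; rewrite ?mul1n.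
    by have := congr1 (@mdeg n) (submK le_m); rewrite mdegD mdegMn mdeg1 mul1n dm => e; lia.
  rewrite (bigD1 i) //= mnmBE mulmnE mnm1E eqxx mul1n mulrA; congr (_ * _).
  apply: eq_bigr => j ji; rewrite mnmBE mulmnE mnm1E eq_sym (negPf ji) mul0n subn0 //.
rewrite exchange_big /= -[in RHS]dm mdegE natr_sum mulr_suml; apply: eq_bigr => i _.
rewrite -big_mkcond /= [in RHS](bigD1 i) //= mulrA.
have [_ /(_ (m i)) ->] := newton_hs natU_field p.
case mi : (m i) => [|k]; first by rewrite big_pred0 // /conv big_ord1 !mul0r.
have le_kd : (k.+1 <= d.+1)%N by rewrite -mi -dm mdegE (bigD1 i) //= leq_addr.
rewrite conv_newton_rec mulr_suml.
rewrite (big_ord_widen _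
  (fun r => p r.+1 * hs p (k - r)%N * \prod_(j | j != i) hs p (m j)) le_kd).
by apply: eq_bigr => r _; rewrite subSS.
Qed.

Lemma msym_pws n k (s : 'S_n) : msym s (pws F n k) = pws F n k.
Proof.
rewrite /pws raddf_sum [RHS](reindex_perm s); apply: eq_bigr => i _ /=.
by rewrite rmorphXn /= /msym mmapX mmap1U.
Qed.

Lemma msym_hs n (p : nat -> {mpoly F[n]}) (s : 'S_n) :
  (forall k, msym s (p k) = p k) -> forall k, msym s (hs p k) = hs p k.
Proof.
move=> sp k; have natU := @natU_mpoly _ natF n.
apply: (newton_uniq natU (newton_morph (msym s) (newton_hs natU p))
  (newton_hs natU p) (n := k)) => // i _.
exact: sp.
Qed.

Lemma msym_jt n (h : nat -> {mpoly F[n]}) (s : 'S_n) mu :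
  (forall k, msym s (h k) = h k) -> msym s (jt n h mu) = jt n h mu.
Proof.
move=> sh; rewrite (jt_morph (msym s)); congr (\det _).
apply/matrixP=> i j; rewrite !mxE /toeplitz; case: ifP => // _; exact: sh.
Qed.

Lemma dhomog_alt_delta n : alt F n (fun j => n - j.+1)%N \is (deg_delta n).-homog.
Proof.
rewrite altE; apply: rpred_sum => s _; apply: rpredZ; rewrite dhomogX /=.
rewrite mdegE /deg_delta [X in _ == X](reindex_perm s) /=.
by apply/eqP/eq_bigr => i _; rewrite mnmE.
Qed.

(* Cauchy identity, multiplied by the Vandermonde determinant of its second set
   of variables. *)
Lemma cauchy_alt n d (p : nat -> F) : (d <= n)%N ->
  hs (pws_scaled n p) d * alt F n (fun j => n - j.+1)%N =
  \sum_(mu <- partitions d) sf (hs p) mu *: alt F n (beta n mu).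
Proof.
move=> dn; rewrite [LHS](@antisym_expand n d) //.
- apply: eq_big_seq => mu mud; congr (_ *: _); have [_ mun mus] := partP mud.
  have mus' := leq_trans mus dn.
  (* Each permutation s in the Vandermonde determinant contributes, up to sign, the kernel
     coefficient at mu + delta - s(delta), a product of complete functions: these are the Leibniz
     terms of the Jacobi-Trudi determinant. *)
  rewrite -(jt_sf _ mus') // jt_leibniz mulrC altE mulr_suml raddf_sum.
  apply: eq_bigr => s _ /=; rewrite -scalerAl mcoeffZ mcoeff_XM mcoeff_hs_pws; congr (_ * _).
  case: (pickP (fun i : 'I_n => beta n mu i < n - (s i).+1)%N) => [i lt_i|le_s].
    rewrite (_ : (_ <= _)%MM = false); last first.
      by apply/mnm_lepP => /(_ i); rewrite !mnmE leqNgt lt_i.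
    by rewrite (bigD1 i) //= /toeplitz leqNgt lt_i mul0r.
  have {}le_s (i : 'I_n) : (n - (s i).+1 <= beta n mu i)%N by rewrite leqNgt [(_ < _)%N]le_s.
  rewrite ifT; last by apply/mnm_lepP => i; rewrite !mnmE.
  rewrite ifT; last first.
    rewrite -mun -(sum_beta_sub mus' le_s) mdegE; apply/eqP/eq_bigr => i _.
    by rewrite mnmBE !mnmE.
  by apply: eq_bigr => i _; rewrite mnmBE !mnmE /toeplitz le_s.
- apply: antisymM; last exact: antisym_alt.
  move=> s; apply: msym_hs => k.
  by rewrite /pws_scaled msymM msym_pws /msym mmapC.
apply: dhomogM; last exact: dhomog_alt_delta.
by apply: dhomog_hs => k; exact: dhomog_pws_scaled.
Qed.

End Expansion.

(** * Littlewood-Richardson coefficients *)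

Section LittlewoodRichardson.

Context (F : fieldType) (natF : forall k, k.+1%:R != 0 :> F).

Let natU n := @natU_mpoly F natF n.
Local Notation H n := (hs (pws F n)).

Lemma jt_free n d (b : seq nat -> F) : (d <= n)%N ->
  \sum_(mu <- partitions d) b mu *: jt n (H n) mu = 0 ->
  forall mu, mu \in partitions d -> b mu = 0.
Proof.
move=> dn sum0; apply: (alt_free dn).
have := congr1 (fun P => P * alt F n (fun j => n - j.+1)%N) sum0.
rewrite mul0r mulr_suml => e; apply: etrans e.
by apply: eq_bigr => mu _; rewrite alt_jt // scalerAl.
Qed.

Lemma cauchy_jt n d (p : nat -> F) : (d <= n)%N ->
  hs (pws_scaled n p) d = \sum_(mu <- partitions d) sf (hs p) mu *: jt n (H n) mu.
Proof.
move=> dn; apply: (mulIf (alt_delta_neq0 F n)); rewrite cauchy_alt // mulr_suml.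
by apply: eq_bigr => mu _; rewrite alt_jt // scalerAl.
Qed.

(** One factor times the alternant of the other is antisymmetric, hence a combination of alternants;
    the Vandermonde determinant is then cancelled. *)
Lemma jt_mul_expand n mu nu : is_part mu -> is_part nu ->
  (sumn mu + sumn nu <= n)%N ->
  exists c : seq nat -> F, jt n (H n) mu * jt n (H n) nu =
    \sum_(rho <- partitions (sumn mu + sumn nu)) c rho *: jt n (H n) rho.
Proof.
move=> mup nup le_n; pose P := jt n (H n) mu * alt F n (beta n nu).
have mus : (size mu <= n)%N by rewrite (leq_trans (size_part mup)) // (leq_trans
  (leq_addr _ _) le_n).
have hH k : H n k \is k.-homog by apply: dhomog_hs => // j; exact: dhomog_pws.
have aP : antisym P.
  apply: antisymM; last exact: antisym_alt.
  by move=> s; apply: msym_jt; apply: msym_hs => // k; exact: msym_pws.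
have hP : P \is ((sumn mu + sumn nu) + deg_delta n)%N.-homog.
  rewrite -addnA; apply: dhomogM; first exact: dhomog_jt.
  rewrite alt_jt //; apply: dhomogM; last exact: dhomog_alt_delta.
  by apply: dhomog_jt => //; rewrite (leq_trans (size_part nup)) // (leq_trans
    (leq_addl _ _) le_n).
exists (fun rho => P@_(mnm_of n (beta n rho))).
have PE : P = jt n (H n) mu * jt n (H n) nu * alt F n (fun j => n - j.+1)%N.
  by rewrite /P (alt_jt natF n nu) mulrA.
apply: (mulIf (alt_delta_neq0 F n)); rewrite -PE mulr_suml.
rewrite [LHS](antisym_expand natF aP hP le_n).
by apply: eq_bigr => rho _; rewrite alt_jt // scalerAl.
Qed.

Definition kill_vars n m : n.-tuple {mpoly F[m]} :=
  [tuple if insub (val i) is Some j then 'X_j else 0 | i < n].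

Lemma kill_vars_hs n m k : (m <= n)%N -> H n k \mPo kill_vars n m = H m k.
Proof.
move=> mn; apply: (newton_uniq (natU m)
  (newton_morph (comp_mpoly (kill_vars n m)) (newton_hs (natU n) (pws F n)))
  (newton_hs (natU m) (pws F m)) (n := k)) => // -[//|i] _ /=.
rewrite /pws raddf_sum /=.
pose X k : {mpoly F[m]} := if insub k is Some j then 'X_j else 0.
rewrite (eq_bigr (fun j : 'I_n => X j ^+ i.+1)); last first.
  by move=> j _; rewrite rmorphXn /= comp_mpolyXU -tnth_nth tnth_mktuple.
transitivity (\sum_(j < n | (j < m)%N) X j ^+ i.+1).
  rewrite [RHS]big_mkcond; apply: eq_bigr => j _; case: ifP => //.
  by rewrite /X; case: insubP => [? -> //|_ _]; rewrite expr0n.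
rewrite -(big_ord_widen n (fun j => X j ^+ i.+1)) //.
by apply: eq_bigr => j _; rewrite /X valK.
Qed.

(** The coefficients are fixed at n = |mu| + |nu|. For larger n, setting the additional variables to
    zero leads back to that case, where linear independence identifies the coefficients. *)
Lemma exists_LR mu nu : is_part mu -> is_part nu ->
  exists c : seq nat -> F,
  (forall rho, rho \notin partitions (sumn mu + sumn nu) -> c rho = 0) /\
  forall n, (sumn mu + sumn nu <= n)%N -> jt n (H n) mu * jt n (H n) nu =
    \sum_(rho <- partitions (sumn mu + sumn nu)) c rho *: jt n (H n) rho.
Proof.
move=> mup nup; set N := (sumn mu + sumn nu)%N.
have [c cE] := jt_mul_expand mup nup (leqnn N).
exists (fun rho => if rho \in partitions N then c rho else 0); split=> [rho /negPf->//|n Nn].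
have [c' c'E] := jt_mul_expand mup nup Nn.
rewrite c'E; apply: eq_big_seq => rho rhoN; rewrite rhoN; congr (_ *: _).
apply/eqP; rewrite -subr_eq0; apply/eqP.
apply: (jt_free (leqnn N) (b := fun rho => c' rho - c rho)) rhoN.
under eq_bigr do rewrite scalerBl; rewrite sumrB -cE; apply/eqP; rewrite subr_eq0; apply/eqP.
have muN : (size mu <= N)%N by rewrite (leq_trans (size_part mup)) // leq_addr.
have nuN : (size nu <= N)%N by rewrite (leq_trans (size_part nup)) // leq_addl.
have killE lam : (size lam <= N)%N -> jt n (H n) lam \mPo kill_vars n N = jt N (H N) lam.
  move=> lamN; rewrite (jt_morph (comp_mpoly (kill_vars n N))) /=.
  have h0 : (comp_mpoly (kill_vars n N) \o H n) 0%N = 1 by rewrite /= hs0 rmorph1.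
  rewrite (jt_sf h0 (leq_trans lamN Nn)) (jt_sf (hs0 _) lamN).
  by apply: eq_sf => k _; exact: kill_vars_hs.
rewrite -(killE mu) // -(killE nu) // -rmorphM /= c'E raddf_sum.
apply: eq_big_seq => lam /partP[_ _ lams] /=.
by rewrite comp_mpolyZ killE.
Qed.

End LittlewoodRichardson.

Lemma natF_num (K : numFieldType) k : k.+1%:R != 0 :> K.
Proof. by rewrite pnatr_eq0. Qed.

Lemma natU_num (K : numFieldType) k : k.+1%:R \is a @GRing.unit K.
Proof. by rewrite unitfE natF_num. Qed.

Lemma schur_jt n mu : schur n mu = tofrac (jt n (hs (pws rat n)) mu).
Proof.
have d0 := alt_delta_neq0 rat n.
rewrite /schur -[alternant _ _]/(alt rat n (beta n mu)).
rewrite -[alternant n _]/(alt rat n (fun j => n - j.+1)%N).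
by rewrite alt_jt ?rmorphM ?mulfK ?tofrac_eq0 //; exact: natF_num.
Qed.

Lemma LRP mu nu : is_part mu -> is_part nu -> is_LR mu nu (LR mu nu).
Proof.
move=> mup nup; apply: ClassicalEpsilon.epsilon_spec.
have [c [c0 cE]] := exists_LR (@natF_num rat) mup nup.
exists c; split=> // n Nn; rewrite !schur_jt -rmorphM /= cE // raddf_sum.
by apply: eq_bigr => rho _; rewrite schur_jt -rmorphM /= mul_mpolyC.
Qed.

Lemma LR_out mu nu rho : is_part mu -> is_part nu ->
  rho \notin partitions (sumn mu + sumn nu) -> LR mu nu rho = 0.
Proof. by move=> mup nup; exact: (LRP mup nup).1. Qed.

Lemma LR_jt mu nu n : is_part mu -> is_part nu -> (sumn mu + sumn nu <= n)%N ->
  jt n (hs (pws rat n)) mu * jt n (hs (pws rat n)) nu =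
  \sum_(rho <- partitions (sumn mu + sumn nu)) LR mu nu rho *: jt n (hs (pws rat n)) rho.
Proof.
move=> mup nup Nn; apply/eqP; rewrite -tofrac_eq; apply/eqP.
have := (LRP mup nup).2 n Nn; rewrite !schur_jt => e.
rewrite rmorphM; apply: (etrans e); rewrite raddf_sum; apply: eq_bigr => rho _.
by rewrite schur_jt -rmorphM /= mul_mpolyC.
Qed.

Lemma schur_psumP mu : is_part mu -> is_schur_psum (schur_psum mu).
Proof.
move=> mup; apply: ClassicalEpsilon.epsilon_spec; set d := sumn mu.
have natR := @natF_num rat.
(* The variable of index k - 1 stands for p_k. Power sums beyond [d] are set to zero, which is
   harmless: the determinant for [mu] involves degrees up to [d] only. *)
pose pX k : {mpoly rat[d]} := if insub k.-1 is Some j then 'X_j else 0.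
exists (sf (hs pX) mu) => n dn.
rewrite schur_jt; congr tofrac; rewrite (sf_morph (comp_mpoly _)).
have dm : (size mu <= n)%N by rewrite (leq_trans (size_part mup)).
rewrite jt_sf //; apply: eq_sf => k kd.
apply/esym; apply: (newton_uniq (natU_mpoly natR n)
  (newton_morph (comp_mpoly [tuple psum n i.+1 | i < d]) (newton_hs (natU_mpoly natR d) pX))
  (newton_hs (natU_mpoly natR n) (pws rat n)) _ kd) => -[//|i] /= lt_id.
by rewrite /pX /= insubT /= comp_mpolyXU -tnth_nth tnth_mktuple.
Qed.

(** * Evaluation at arbitrary power sums over an algebraically closed field *)

Section Evaluation.

Context (K : numClosedFieldType).
Implicit Types (p : nat -> K) (mu nu rho : seq nat).

Let natK := @natU_num K.

Lemma eval_jt n (x : 'I_n -> K) p N mu :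
  (forall k, (0 < k <= N)%N -> \sum_i x i ^+ k = p k) ->
  (size mu <= n)%N -> (sumn mu <= N)%N ->
  mmap ratr x (jt n (hs (pws rat n)) mu) = sf (hs p) mu.
Proof.
move=> xp mun muN; have natR := natU_mpoly (@natF_num rat) n.
rewrite (jt_morph (mmap ratr x)) jt_sf //= ?hs0 ?rmorph1 //.
apply: eq_sf => k kmu.
apply: (newton_uniq natK (newton_morph (mmap ratr x) (newton_hs natR (pws rat n)))
  (newton_hs natK p) _ (leq_trans kmu muN)).
move=> i iN; rewrite -xp // /= /pws raddf_sum; apply: eq_bigr => j _ /=.
by rewrite rmorphXn /= mmapX mmap1U.
Qed.

(** For x with power sums 1/[n] up to |mu|, evaluating [schur_psum mu] amounts to evaluating the
    Schur polynomial at x. *)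
Lemma Wpart_sf (v : K) mu : is_part mu ->
  Wpart v mu = sf (hs (fun k => (qnum v k)^-1)) mu.
Proof.
move=> mup; set d := sumn mu.
have [x xp] := exists_psum natK (fun k => (qnum v k)^-1) d.
rewrite -(eval_jt xp (size_part mup) (leqnn _)).
have /eqP := schur_psumP mup (leqnn d).
rewrite schur_jt tofrac_eq => /eqP ->.
rewrite /Wpart; elim/mpolyind: (schur_psum mu) => [|c m P _ _ IH].
  by rewrite raddf0 comp_mpoly0 raddf0.
rewrite raddfD comp_mpolyD raddfD /= IH; congr (_ + _).
rewrite comp_mpolyZ comp_mpolyX !mmapZ mmapX rmorph_prod; congr (_ * _).
apply: eq_bigr => i _; rewrite rmorphXn /= tnth_mktuple; congr (_ ^+ _).
rewrite -xp ?ltn_ord // raddf_sum; apply: eq_bigr => j _ /=.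
by rewrite rmorphXn /= mmapX mmap1U.
Qed.

Lemma sf_LR p mu nu : is_part mu -> is_part nu ->
  \sum_(rho <- partitions (sumn mu + sumn nu)) ratr (LR mu nu rho) * sf (hs p) rho =
  sf (hs p) mu * sf (hs p) nu.
Proof.
move=> mup nup; set N := (sumn mu + sumn nu)%N.
have [x xp] := exists_psum natK p N.
have muN : (sumn mu <= N)%N := leq_addr _ _.
have nuN : (sumn nu <= N)%N := leq_addl _ _.
transitivity (mmap ratr x (jt N (hs (pws rat N)) mu * jt N (hs (pws rat N)) nu)).
  rewrite (LR_jt mup nup (leqnn N)) raddf_sum.
  apply: eq_big_seq => rho /partP[_ rhoN rhos] /=.
  by rewrite mmapZ (eval_jt xp rhos) // rhoN.
rewrite rmorphM; congr (_ * _); apply: (eval_jt xp) => //.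
  exact: leq_trans (size_part mup) muN.
exact: leq_trans (size_part nup) nuN.
Qed.

Lemma cauchy p p' d :
  \sum_(mu <- partitions d) sf (hs p) mu * sf (hs p') mu = hs (fun k => p k * p' k) d.
Proof.
have natM := natU_mpoly (@natF_num K) d.
have [x xp] := exists_psum natK p' d.
have := congr1 (meval x) (cauchy_jt (@natF_num K) p (leqnn d)).
have -> : (hs (pws_scaled d p) d).@[x] = hs (fun k => p k * p' k) d.
  apply: (newton_uniq natK (newton_morph (meval x) (newton_hs natM _)) 
    (newton_hs natK _) (n := d)) => // i id.
  rewrite /= /pws_scaled mevalM mevalC -xp // /pws raddf_sum; congr (_ * _).
  by apply: eq_bigr => j _; rewrite /= rmorphXn /= mevalXU.
move=> ->; rewrite raddf_sum; apply: eq_big_seq => mu /partP[_ mud mus] /=.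
rewrite mevalZ (jt_morph (meval x)) jt_sf //= ?hs0 ?rmorph1 //; congr (_ * _).
apply/esym/eq_sf => k; rewrite mud => kd.
apply: (newton_uniq natK (newton_morph (meval x) (newton_hs natM _))
  (newton_hs natK _) _ kd) => i id.
by rewrite /= -xp // /pws raddf_sum; apply: eq_bigr => j _; rewrite /= rmorphXn /= mevalXU.
Qed.

Lemma LR_jt_num mu nu n : is_part mu -> is_part nu -> (sumn mu + sumn nu <= n)%N ->
  jt n (hs (pws K n)) mu * jt n (hs (pws K n)) nu =
  \sum_(rho <- partitions (sumn mu + sumn nu)) ratr (LR mu nu rho) *: jt n (hs (pws K n)) rho.
Proof.
move=> mup nup Nn; have natM := natU_mpoly (@natF_num K) n;
  have natR := natU_mpoly (@natF_num rat) n.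
have fE lam : map_mpoly (@ratr K) (jt n (hs (pws rat n)) lam) = jt n (hs (pws K n)) lam.
  rewrite (jt_morph (map_mpoly (@ratr K))).
  congr (\det _); apply/matrixP=> i j; rewrite !mxE /toeplitz; case: ifP => // _.
  set k := (_ - _)%N.
  apply: (newton_uniq natM (newton_morph (map_mpoly (@ratr K)) (newton_hs natR _))
    (newton_hs natM _) _ (leqnn k)) => r _.
  by rewrite /= /pws raddf_sum; apply: eq_bigr => l _; rewrite /= rmorphXn /= map_mpolyX.
rewrite -!fE.
transitivity (map_mpoly (@ratr K) (jt n (hs (pws rat n)) mu * jt n (hs (pws rat n)) nu)).
  by rewrite rmorphM.
rewrite (LR_jt mup nup Nn) raddf_sum; apply: eq_bigr => rho _ /=.
by rewrite map_mpolyZ fE.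
Qed.

(** Dual to the multiplication rule: the Cauchy kernel of p + p' is the convolution of the kernels
    of p and p'. All kernels are expanded in Schur polynomials of [d] auxiliary variables and the
    coefficients compared. *)
Lemma sf_coproduct p p' d mu : mu \in partitions d ->
  \sum_(i < d.+1) \sum_(lam <- partitions i) \sum_(tau <- partitions (d - i))
     ratr (LR lam tau mu) * (sf (hs p) lam * sf (hs p') tau) =
  sf (hs (fun k => p k + p' k)) mu.
Proof.
move=> mud; apply/eqP; rewrite eq_sym -subr_eq0; apply/eqP.
have natM := natU_mpoly (@natF_num K) d.
pose b rho := sf (hs (fun k => p k + p' k)) rho -
  \sum_(i < d.+1) \sum_(lam <- partitions i) \sum_(tau <- partitions (d - i))
     ratr (LR lam tau rho) * (sf (hs p) lam * sf (hs p') tau).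
apply: (jt_free (@natF_num K) (leqnn d) (b := b)) mud.
under eq_bigr do rewrite scalerBl.
rewrite sumrB -(cauchy_jt (@natF_num K) _ (leqnn d)).
apply/eqP; rewrite subr_eq0; apply/eqP.
transitivity (conv (hs (pws_scaled d p)) (hs (pws_scaled d p')) d).
  rewrite -(hsD natM); apply: (eq_hs natM (n := d)) => // i _.
  by rewrite /pws_scaled mpolyCD mulrDl.
transitivity (\sum_(i < d.+1) \sum_(lam <- partitions i) \sum_(tau <- partitions (d - i))
    (sf (hs p) lam * sf (hs p') tau) *: (jt d (hs (pws K d)) lam * jt d (hs (pws K d)) tau)).
  apply: eq_bigr => i _; rewrite !cauchy_jt ?leq_subr ?leq_ord //; try exact: natF_num.
  rewrite mulr_suml; apply: eq_bigr => lam _; rewrite mulr_sumr; apply: eq_bigr => tau _.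
  by rewrite -scalerAl -scalerAr scalerA.
under [RHS]eq_bigr do rewrite scaler_suml.
rewrite [RHS]exchange_big /=; apply: eq_bigr => i _.
under [RHS]eq_bigr do rewrite scaler_suml.
rewrite [RHS]exchange_big /=; apply: eq_big_seq => lam lami.
under [RHS]eq_bigr do rewrite scaler_suml.
rewrite [RHS]exchange_big /=; apply: eq_big_seq => tau taui.
have [lamp lamE _] := partP lami; have [taup tauE _] := partP taui.
have lamtau : (sumn lam + sumn tau)%N = d by rewrite lamE tauE subnKC // leq_ord.
rewrite LR_jt_num ?lamtau // scaler_sumr; apply: eq_bigr => rho _.
by rewrite scalerA mulrC.
Qed.

End Evaluation.

(** * Principal specialization *)

Lemma subn_rev n k : (k < n)%N -> (n - (n - k.+1).+1)%N = k.
Proof. by move=> kn; lia. Qed.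

Lemma det_delta (R : comNzRingType) n (y : 'I_n -> R) :
  \det (\matrix_(i < n, j < n) y i ^+ (n - j.+1)) =
  \prod_(i < n) \prod_(j < n | (i < j)%N) (y i - y j).
Proof.
pose rho := perm (@rev_ord_inj n).
pose V := Vandermonde n (\row_j y (rev_ord j)).
have -> : \matrix_(i < n, j < n) y i ^+ (n - j.+1) = (row_perm rho (col_perm rho V))^T.
  by apply/matrixP=> i j; rewrite !mxE !permE rev_ordK.
rewrite det_tr row_permE col_permE !det_mulmx !det_perm odd_permV mulrCA -expr2.
rewrite sqrr_sign mulr1 det_Vandermonde.
under eq_bigr => i _ do rewrite big_mkcond.
rewrite exchange_big (reindex_inj rev_ord_inj) /=; apply: eq_bigr => i _.
rewrite [RHS]big_mkcond (reindex_inj rev_ord_inj) /=; apply: eq_bigr => j _.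
by rewrite !mxE !rev_ordK ltn_sub2lE // ltnS.
Qed.

(** Replacing the monomial of degree c by [P c] is a triangular change of basis with the
    coefficients [(P c)_c] on the diagonal. *)
Lemma det_horner_lead (R : comNzRingType) n (P : nat -> {poly R}) (y : 'I_n -> R) :
  (forall c, (size (P c) <= c.+1)%N) ->
  \det (\matrix_(i < n, j < n) (P (n - j.+1)%N).[y i]) =
  (\prod_(c < n) (P c)`_c) * \det (\matrix_(i < n, j < n) y i ^+ (n - j.+1)).
Proof.
move=> sP; pose T := \matrix_(k < n, j < n) (P (n - j.+1)%N)`_(n - k.+1).
have -> : \matrix_(i < n, j < n) (P (n - j.+1)%N).[y i] =
    (\matrix_(i < n, j < n) y i ^+ (n - j.+1)) *m T.
  apply/matrixP=> i j; rewrite !mxE.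
  rewrite (@horner_coef_wide _ n); last first.
    by rewrite (leq_trans (sP _)) // subnSK // leq_subr.
  rewrite (reindex_inj rev_ord_inj); apply: eq_bigr => k _.
  by rewrite !mxE mulrC.
rewrite det_mulmx mulrC; congr (_ * _); rewrite det_trig.
  rewrite (reindex_inj rev_ord_inj); apply: eq_bigr => k _.
  by rewrite !mxE subn_rev.
apply/is_trig_mxP=> k j kj; rewrite !mxE nth_default // (leq_trans (sP _)) //.
by apply: ltn_sub2l; rewrite ?ltnS // (leq_ltn_trans kj).
Qed.

Section PrincipalSpecialization.

Context (F : fieldType) (natF : forall k, k.+1%:R != 0 :> F) (v : F).
Hypotheses (v0 : v != 0) (qn : forall k, qnum v k.+1 != 0).

Let natU := natU_field natF.

Definition wps n : F := (qnum v n)^-1.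

(** The alphabet behind [wps] is q^(-1/2), q^(-3/2), ...; multiplying it by q adds the letter v =
    q^(1/2). *)
Lemma wps_shift n : (0 < n)%N -> (v ^+ 2) ^+ n * wps n = wps n + v ^+ n.
Proof.
case: n => // n _; apply: (mulIf (qn n)).
rewrite mulrDl -mulrA mulVf // mulr1 /qnum mulrBr mulfV ?expf_neq0 //.
by rewrite -exprM mulnC exprM expr2 addrC subrK.
Qed.

(** Computing the complete functions of the shifted alphabet in two ways gives q^(k+1) h_(k+1) =
    h_(k+1) + v q^k h_k. *)
Lemma hs_wpsS k : hs wps k.+1 = hs wps k * v ^+ k / qnum v k.+1.
Proof.
have shift m : (v ^+ 2) ^+ m * hs wps m = conv (hs wps) (fun i => v ^+ i) m.
  rewrite -(hs_scale natU) (eq_hs natU (p' := fun n => wps n + v ^+ n) (n := m)) //.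
    by rewrite hsD //; apply: eq_conv => // i _; rewrite -(newton_hsE natU (newton_geom v)).
  by move=> i /andP[i0 _]; rewrite wps_shift.
have convS m : conv (hs wps) (fun i => v ^+ i) m.+1 =
    hs wps m.+1 + v * conv (hs wps) (fun i => v ^+ i) m.
  rewrite /conv big_ord_recr /= subnn mulr1 addrC; congr (_ + _).
  rewrite mulr_sumr; apply: eq_bigr => i _.
  by rewrite subSn ?leq_ord // exprS mulrCA.
have := shift k.+1; rewrite convS -shift => e.
apply: (mulIf (qn k)); rewrite divfK //.
apply: (@mulfI _ (v ^+ k.+1)); first by rewrite expf_neq0.
have xx : v ^+ k.+1 * v ^+ k.+1 = (v ^+ 2) ^+ k.+1 by rewrite -exprD addnn -mul2n exprM.
rewrite /qnum mulrCA mulrBr xx mulfV ?expf_neq0 // mulrBr mulr1 [X in X - _]mulrC e.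
by rewrite -exprM mul2n -addnn exprD exprS; ring.
Qed.

(** In a row, h_(a-c) / h_a is a polynomial of degree c in q^(-a), which prepares a Vandermonde
    determinant. For c > a the factor r = a vanishes, in agreement with h being zero at negative
    indices. *)
Lemma toeplitz_wps a c : toeplitz (hs wps) a c =
  hs wps a * (v ^+ c * \prod_(r < c) (1 - v ^+ (2 * r) * v ^- (2 * a))).
Proof.
elim: c => [|c IH]; first by rewrite /toeplitz subn0 big_ord0 !mulr1.
rewrite big_ord_recr /= exprS.
have rearr (x y z t : F) : x * (v * y * (z * t)) = x * (y * z) * (v * t) by ring.
rewrite rearr -IH {IH rearr} /toeplitz.
case: (ltngtP c a) => [lt_ca|lt_ac|->]; last first.
- by rewrite mulfV ?expf_neq0 // subrr !mulr0.
- by rewrite mul0r.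
have [m am] : exists m, a = (c + m.+1)%N by exists (a - c).-1;
  rewrite prednK ?subn_gt0 // subnKC // ltnW.
have e1 : (c + m.+1 - c.+1)%N = m by lia.
have e2 : (c + m.+1 - c)%N = m.+1 by lia.
rewrite am e1 e2.
have -> : v ^+ (2 * c) * v ^- (2 * (c + m.+1)) = v ^- (2 * m.+1).
  by rewrite mulnDr exprD invfM mulrA mulfV ?mul1r // expf_neq0.
have q : v ^+ m * (v * (1 - v ^- (2 * m.+1))) = qnum v m.+1.
  rewrite mulrA -exprSr mulrBr mulr1 mul2n -addnn exprD invfM mulrA mulfV ?mul1r //.
  by rewrite expf_neq0.
by rewrite hs_wpsS mulrAC -(mulrA (hs wps m)) q mulfK.
Qed.

Definition zbeta n mu i := v ^- (2 * beta n mu i).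

Lemma jt_wps n mu : jt n (hs wps) mu =
  \prod_(i < n) hs wps (beta n mu i) * \prod_(c < n) v ^+ (c * c) *
  \prod_(i < n) \prod_(j < n | (i < j)%N) (zbeta n mu j - zbeta n mu i).
Proof.
(* The product of [toeplitz_wps] as a polynomial in - q^(-a). Its leading coefficient v^(c(c-1)) and
   the column factor v^c combine to [v ^+ (c * c)]. *)
pose Q c : {poly F} := \prod_(r < c) (1 + v ^+ (2 * r) *: 'X).
have sQ c : (size (Q c) <= c.+1)%N /\ (Q c)`_c = \prod_(r < c) v ^+ (2 * r).
  elim: c => [|c [IHs IHc]]; first by rewrite /Q !big_ord0 size_poly1 coef1.
  rewrite /Q !big_ord_recr /= -/(Q c) mulrDr mulr1 -scalerAr; split.
    rewrite (leq_trans (size_polyD _ _)) // geq_max (leq_trans IHs) //=.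
    rewrite (leq_trans (size_scale_leq _ _)) //.
    by rewrite (leq_trans (size_polyMleq _ _)) // size_polyX addn2.
  by rewrite coefD coefZ coefMX /= nth_default // add0r IHc mulrC.
pose W := \matrix_(i < n, j < n) (Q (n - j.+1)%N).[- zbeta n mu i].
have -> : jt n (hs wps) mu = \det (diag_mx (\row_i hs wps (beta n mu i)) *m W *m
    diag_mx (\row_j v ^+ (n - j.+1))).
  congr (\det _); apply/matrixP=> i j; rewrite mul_mx_diag mul_diag_mx !mxE toeplitz_wps.
  rewrite -mulrA (mulrC _ (v ^+ _)); congr (_ * (_ * _)).
  rewrite horner_prod; apply: eq_bigr => r _.
  by rewrite hornerD hornerZ hornerX hornerC mulrN.
rewrite !det_mulmx !det_diag det_horner_lead => [|c]; last by case: (sQ c).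
rewrite det_delta -!mulrA; congr (_ * _).
  by apply: eq_bigr => i _; rewrite mxE.
rewrite mulrCA mulrC; congr (_ * _).
  rewrite [X in _ * X](reindex_inj rev_ord_inj) -big_split; apply: eq_bigr => c _;
    rewrite mxE subn_rev // (sQ c).2 /=.
  elim: (c : nat) => /= [|k IH]; first by rewrite big_ord0 mul1r.
  rewrite big_ord_recr /= exprSr mulrACA IH -exprSr -exprD; congr (_ ^+ _); lia.
by apply: eq_bigr => i _; apply: eq_bigr => j _; rewrite opprK addrC.
Qed.

Lemma hs_wps_neq0 k : hs wps k != 0.
Proof.
elim: k => [|k IH]; first by rewrite hs0 oner_neq0.
by rewrite hs_wpsS !mulf_neq0 ?invr_neq0 ?expf_neq0.
Qed.

Lemma exprv_inj a b : v ^+ (2 * a) = v ^+ (2 * b) -> a = b.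
Proof.
wlog ab : a b / (a < b)%N.
  by move=> th; case: (ltngtP a b) => // lt_ab e; [apply: th | apply/esym/th].
move=> e; have [m bm] : exists m, b = (a + m.+1)%N by exists (b - a).-1; lia.
have := qn m; rewrite /qnum; case/eqP; apply/eqP; rewrite subr_eq0; apply/eqP.
apply: (@mulfI _ (v ^+ m.+1)); first by rewrite expf_neq0.
rewrite mulfV ?expf_neq0 // -exprD addnn -mul2n.
apply: (@mulfI _ (v ^+ (2 * a))); first by rewrite expf_neq0.
by rewrite mulr1 -exprD -mulnDr -bm -e.
Qed.

(** The exponents [beta] are distinct and v^2 is not a root of unity, so no difference in the
    product formula vanishes. *)
Lemma sf_wps_neq0 mu : sorted geq mu -> sf (hs wps) mu != 0.
Proof.
move=> mus; rewrite /sf jt_wps !mulf_neq0 //; apply/prodf_neq0 => i _.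
- exact: hs_wps_neq0.
- by rewrite expf_neq0.
apply/prodf_neq0 => j ij; rewrite subr_eq0; apply/eqP => /invr_inj/exprv_inj e.
by have := strict_beta mus (introT andP (conj ij (ltn_ord j))); rewrite e ltnn.
Qed.

End PrincipalSpecialization.

(** * Transposition *)

Section Transpose.

Implicit Types mu nu : seq nat.

Lemma count_gtn mu j i : sorted geq mu ->
  (i < count (fun x => j < x)%N mu)%N = (j < nth 0 mu i)%N.
Proof.
have geq_trans : transitive geq by move=> a b c ba cb; exact: leq_trans cb ba.
elim: mu i => [|x s IH] i xs; first by rewrite nth_nil.
have {}IH := IH _ (path_sorted xs); have /allP s_le := order_path_min geq_trans xs.
case: i => [|i] /=.
  case: (ltnP j x) => //= jx; rewrite add0n -has_count; apply/negbTE/hasPn => y /s_le yx.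
  by rewrite -leqNgt (leq_trans yx).
rewrite -IH; case: (ltnP j x) => //= jx; rewrite add0n.
suff -> : count (fun x0 => j < x0)%N s = 0%N by [].
by apply/eqP; rewrite -leqn0 leqNgt -has_count; apply/hasPn => y /s_le yx;
  rewrite -leqNgt (leq_trans yx).
Qed.

Lemma size_transpose mu : size (transpose mu) = head 0%N mu.
Proof. by rewrite size_map size_iota. Qed.

Lemma nth_transpose mu j : sorted geq mu ->
  nth 0%N (transpose mu) j = count (fun x => j < x)%N mu.
Proof.
move=> mus; have [jh|hj] := ltnP j (head 0%N mu).
  by rewrite (nth_map 0%N) ?size_iota // nth_iota.
rewrite nth_default ?size_transpose //; apply/esym/eqP.
by rewrite -leqn0 leqNgt count_gtn // nth0 -leqNgt.
Qed.

(** Both sides mean that the cell (i, j) lies in the diagram. *)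
Lemma ltn_transpose mu i j : sorted geq mu ->
  (i < nth 0 (transpose mu) j)%N = (j < nth 0 mu i)%N.
Proof. by move=> mus; rewrite nth_transpose // count_gtn. Qed.

Lemma is_part_transpose mu : is_part mu -> is_part (transpose mu).
Proof.
case/andP=> mus _; apply/andP; split.
  apply/(sortedP 0%N) => j _ /=; rewrite leqNgt; apply/negP => lt_j.
  have := lt_j; rewrite ltn_transpose // => /ltnW.
  by rewrite -ltn_transpose // ltnn.
apply/negP => /(nthP 0%N)[j]; rewrite size_transpose => jh j0.
by have := ltn_transpose 0 j mus; rewrite j0 nth0 jh.
Qed.

Lemma transposeK mu : is_part mu -> transpose (transpose mu) = mu.
Proof.
move=> mup; have mup' := is_part_transpose mup.
have [/andP[mus _] /andP[mus' _]] := (mup, mup').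
apply: part_eqP => // [|i]; first exact: is_part_transpose.
have lt_eq j : (j < nth 0 (transpose (transpose mu)) i)%N = (j < nth 0 mu i)%N.
  by rewrite ltn_transpose // ltn_transpose.
case: (ltngtP (nth 0 (transpose (transpose mu)) i) (nth 0 mu i))%N => // lt_i.
  by have := lt_eq (nth 0 (transpose (transpose mu)) i)%N; rewrite ltnn lt_i.
by have := lt_eq (nth 0 mu i)%N; rewrite ltnn lt_i.
Qed.

Lemma leq_nth_sumn mu i : (nth 0 mu i <= sumn mu)%N.
Proof.
elim: mu i => [|x s IH] [|i] //=; first exact: leq_addr.
exact: leq_trans (IH i) (leq_addl _ _).
Qed.

Lemma sumn_transpose mu : is_part mu -> sumn (transpose mu) = sumn mu.
Proof.
move=> mup; have [/andP[mus _] mu_size] := (mup, size_part mup).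
have sumE nu : (size nu <= sumn mu)%N -> (forall i, nth 0 nu i <= sumn mu)%N ->
    sumn nu = (\sum_(i < sumn mu) \sum_(j < sumn mu) (j < nth 0 nu i))%N.
  move=> nus nu_le; rewrite -(sumn_nth nus); apply: eq_bigr => i _.
  rewrite -big_mkcond /= -(big_ord_widen (sumn mu) (fun=> 1%N)) //.
  by rewrite sum1_card card_ord.
rewrite [RHS]sumE //; last exact: leq_nth_sumn.
rewrite sumE => [||j]; last 2 first.
- by rewrite size_transpose -nth0 leq_nth_sumn.
- by rewrite nth_transpose // (leq_trans (count_size _ _)).
rewrite exchange_big; apply: eq_bigr => i _; apply: eq_bigr => j _.
by rewrite ltn_transpose.
Qed.

Lemma transpose_partitions d mu : mu \in partitions d -> transpose mu \in partitions d.
Proof.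
rewrite !mem_partitions => /andP[mup]; rewrite sumn_transpose //.
by rewrite is_part_transpose.
Qed.

Lemma perm_transpose d : perm_eq (map transpose (partitions d)) (partitions d).
Proof.
have injT : {in partitions d &, injective transpose}.
  move=> mu nu /partP[mup _ _] /partP[nup _ _] e.
  by rewrite -(transposeK mup) e transposeK.
apply: uniq_perm => [||mu].
- by rewrite (map_inj_in_uniq injT) partitions_uniq.
- exact: partitions_uniq.
apply/mapP/idP => [[nu nud ->]|mud]; first exact: transpose_partitions.
exists (transpose mu); first exact: transpose_partitions.
by have [mup _ _] := partP mud; rewrite transposeK.
Qed.

Lemma big_transpose (V : nmodType) d (f : seq nat -> V) :
  \sum_(mu <- partitions d) f (transpose mu) = \sum_(mu <- partitions d) f mu.
Proof. by rewrite -[RHS](perm_big _ (perm_transpose d)) [RHS]big_map. Qed.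

End Transpose.

(** * Jacobi-Trudi determinants of a partition and of its transpose *)

Section Duality.

Variables (mu : seq nat) (mup : is_part mu).
Let n := size mu.
Let m := head 0%N mu.
Let mus : sorted geq mu. Proof. by case/andP: mup. Qed.

(** With mu' the transpose, the numbers mu_i + n - i - 1 for i < n and n + j - mu'_j for j < m
    exhaust 0, ..., n + m - 1 without repetition: they label the vertical and the horizontal steps
    of the boundary path of the diagram. *)
Let row_fun (i : 'I_(n + m)) : nat :=
  match split i with
  | inl i' => beta n mu i'
  | inr j => (n + j - nth 0 (transpose mu) j)%N
  end.

Let nth_tr_le j : (nth 0 (transpose mu) j <= n)%N.
Proof. by rewrite nth_transpose // count_size. Qed.

Let row_fun_lt i : (row_fun i < n + m)%N.
Proof.
rewrite /row_fun; case: splitP => j _; last first.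
  by rewrite (leq_ltn_trans (leq_subr _ _)) // ltn_add2l.
rewrite /beta; have lt_j := ltn_ord j.
have : (nth 0 mu j <= m)%N.
  by rewrite leqNgt -ltn_transpose // nth_default // size_transpose.
lia.
Qed.

Let row_fun_inj : injective (fun i => Ordinal (row_fun_lt i)).
Proof.
have cross (i : 'I_n) (j : 'I_m) : beta n mu i != (n + j - nth 0 (transpose mu) j)%N.
  have lt_i := ltn_ord i; have := ltn_transpose i j mus; have := nth_tr_le j.
  by rewrite /beta; case: ltnP => ? ? /esym; case: ltnP => //; lia.
have sb (i j : 'I_n) : beta n mu i = beta n mu j -> i = j.
  move=> e; apply: val_inj; case: (ltngtP i j) => // ij.
    by have := strict_beta mus (introT andP (conj ij (ltn_ord j))); rewrite e ltnn.
  by have := strict_beta mus (introT andP (conj ij (ltn_ord i))); rewrite e ltnn.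
have st (i j : 'I_m) :
    (n + i - nth 0 (transpose mu) i)%N = (n + j - nth 0 (transpose mu) j)%N -> i = j.
  have mono (a b : nat) : (a < b)%N -> (nth 0 (transpose mu) b <= nth 0 (transpose mu) a)%N.
    move=> ab; rewrite leqNgt; apply/negP => lt_a.
    have := lt_a; rewrite ltn_transpose // => bm.
    by have := ltn_trans ab bm; rewrite -ltn_transpose // ltnn.
  move=> e; apply: val_inj; have := nth_tr_le i; have := nth_tr_le j.
  case: (ltngtP i j) => // ij; have := mono _ _ ij; lia.
move=> i j /(congr1 val) /=; rewrite /row_fun.
case: (splitP i) => i' ei; case: (splitP j) => j' ej e; apply: val_inj; rewrite /= ei ej.
- by rewrite (sb _ _ e).
- by case/eqP: (cross i' j').
- by case/eqP: (cross j' i').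
- by rewrite (st _ _ e).
Qed.

(** The first n columns are reversed, as the Jacobi-Trudi matrix of [mu] lists them; the last m keep
    their order. *)
Let col_fun (i : 'I_(n + m)) : nat := if (i < n)%N then (n - i.+1)%N else i.

Let col_fun_lt i : (col_fun i < n + m)%N.
Proof. by rewrite /col_fun; case: ifP => // _; have := ltn_ord i; lia. Qed.

Let col_fun_inj : injective (fun i => Ordinal (col_fun_lt i)).
Proof.
move=> i j /(congr1 val) /=; rewrite /col_fun => e; apply: val_inj => /=; move: e.
by case: (ltnP i n); case: (ltnP j n) => /= *; lia.
Qed.

(* The Jacobi-Trudi determinants of mu in h and of its transpose in the inverse
   sequence are complementary minors of inverse Toeplitz matrices. *)
Lemma sf_transpose_sign : exists b : bool, forall (R : comNzRingType) (h e : nat -> R),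
  h 0%N = 1 -> (forall k, conv h e k = seq1 R k) ->
  sf h mu = (-1) ^+ b * sf e (transpose mu).
Proof.
pose s := perm row_fun_inj; pose t := perm col_fun_inj.
(* The sign is chosen before the ring and the sequences, so it can be determined at one convenient
   specialization. *)
exists (odd_perm s (+) odd_perm t) => R h e h0 he.
have e0 : e 0%N = 1 by have := he 0%N; rewrite conv0E h0 mul1r.
pose L (g : nat -> R) := \matrix_(a < n + m, c < n + m) toeplitz g a c.
have LL : L h *m L e = 1%:M.
  apply/matrixP=> a c; rewrite !mxE.
  under eq_bigr do rewrite !mxE.
  have [ca|ac] := leqP c a; last first.
    rewrite big1 => [|b _]; first by rewrite -val_eqE /= ltn_eqF.
    rewrite /toeplitz; case: ifP => ba; last by rewrite mul0r.
    by rewrite leqNgt (leq_ltn_trans ba ac) mulr0.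
  transitivity (conv e h (a - c));
    last by rewrite convC he /seq1 subn_eq0 -val_eqE /= eqn_leq ca andbT.
  pose f (b : nat) := toeplitz h a b * toeplitz e b c.
  have le_cN : (c <= n + m)%N := ltnW (ltn_ord c).
  rewrite -(big_mkord xpredT f) (big_cat_nat (leq0n c) le_cN) /= big_nat_cond.
  rewrite big1 => [|b]; last first.
    by rewrite andbT /f {2}/toeplitz => /andP[_ bc]; rewrite leqNgt bc mulr0.
  rewrite add0r (big_cat_nat (leqW ca) (ltn_ord a)) /= [X in _ + X]big_nat_cond.
  rewrite [X in _ + X]big1 => [|b]; last first.
    by rewrite andbT /f {1}/toeplitz => /andP[ab _]; rewrite leqNgt ab mul0r.
  rewrite addr0 -{1}(add0n (c : nat)) big_addn subSn // big_mkord /conv.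
  apply: eq_bigr => k _; have le_k := leq_ord k.
  have kca : (k + c <= a)%N by lia.
  by rewrite /f /toeplitz kca leq_addl addnK mulrC; congr (_ * h _); lia.
pose A := mxsub s t (L h); pose B := mxsub t s (L e).
have AB : A *m B = 1%:M.
  apply/matrixP=> i j; rewrite !mxE -(inj_eq (@perm_inj _ s)).
  have := congr1 (fun M : 'M_(n + m) => M (s i) (s j)) LL; rewrite !mxE => <-.
  by rewrite [RHS](reindex_perm t); apply: eq_bigr => k _; rewrite !mxE.
have detA : \det A = (-1) ^+ (odd_perm s (+) odd_perm t).
  have -> : A = row_perm s (col_perm t (L h)) by apply/matrixP=> i j; rewrite !mxE.
  rewrite row_permE col_permE !det_mulmx !det_perm odd_permV signr_addb det_trig.
    by rewrite big1 ?mul1r // => i _; rewrite mxE /toeplitz leqnn subnn.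
  by apply/is_trig_mxP=> i j ij; rewrite mxE /toeplitz leqNgt ij.
have AE : \det (ulsubmx A) = sf h mu.
  congr (\det _); apply/matrixP=> i j; rewrite !mxE !permE /= /row_fun /col_fun.
  by rewrite (unsplitK (inl i)) /= ltn_ord.
have BE : \det (drsubmx B) = sf e (transpose mu).
  rewrite -det_tr /sf size_transpose -/m; congr (\det _).
  apply/matrixP=> i j; rewrite !mxE !permE /= /row_fun /col_fun.
  rewrite (unsplitK (inr i)) /= ltnNge leq_addr /= /toeplitz.
  have le_i := nth_tr_le i; have lt_i := ltn_ord i; have lt_j := ltn_ord j.
  have -> : (n + i - nth 0 (transpose mu) i <= n + j)%N =
            (m - j.+1 <= beta m (transpose mu) i)%N by rewrite /beta; lia.
  by case: ifP => // _; congr e; rewrite /beta; lia.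
rewrite -AE -BE -detA.
have := AB; rewrite -[A in A *m _]submxK -[B]submxK mulmx_block (scalar_mx_block n m 1).
move=> /eq_block_mx[_ ur0 _ dr1].
(* Jacobi's identity for complementary minors: with the first block column of [B] replaced by that
   of the identity, determinants give det A det(drsubmx B) = det(ulsubmx A). *)
have : A *m block_mx 1%:M (ursubmx B) 0 (drsubmx B) = block_mx (ulsubmx A) 0 (dlsubmx A) 1%:M.
  by rewrite -[A in LHS]submxK mulmx_block ur0 dr1 !mulmx1 !mulmx0 !addr0.
by move=> /(congr1 determinant);
  rewrite det_mulmx det_ublock det_lblock !det1 mul1r mulr1 submxK => <-.
Qed.

End Duality.

Lemma prod_ltn_const (R : comNzRingType) n i (x : R) : (i < n)%N ->
  \prod_(j < n | (i < j)%N) x = x ^+ (n - i.+1).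
Proof.
move=> lt_in; rewrite prodr_const; congr (_ ^+ _).
have := cardC [pred j : 'I_n | (i < j)%N]; rewrite card_ord.
have -> : #|[predC [pred j : 'I_n | (i < j)%N]]| = i.+1.
  rewrite -sum1_card (eq_bigl (fun j : 'I_n => (j < i.+1)%N)) => [|j].
    by rewrite -(big_ord_widen n (fun=> 1%N)) // sum1_card card_ord.
  by rewrite inE /= -leqNgt.
by move=> cardE; apply: (@addIn i.+1); rewrite subnK.
Qed.

Lemma prod_ltn_split (R : comNzRingType) n (f g : 'I_n -> R) :
  \prod_(i < n) \prod_(j < n | (i < j)%N) (f i * g j) =
  \prod_(i < n) (f i ^+ (n - i.+1) * g i ^+ i).
Proof.
rewrite [RHS]big_split /=.
under eq_bigr => i _ do rewrite big_split prod_ltn_const //=.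
rewrite big_split /=; congr (_ * _).
under eq_bigr => i _ do rewrite big_mkcond /=.
rewrite exchange_big /=; apply: eq_bigr => j _.
rewrite -big_mkcond /= -(big_ord_widen n (fun=> g j)); last exact: ltnW.
by rewrite prodr_const card_ord.
Qed.

(** * Behaviour of the principal specialization under v -> 1/v *)

Section Inversion.

Context (F : fieldType) (natF : forall k, k.+1%:R != 0 :> F) (v : F).
Hypotheses (v0 : v != 0) (qn : forall k, qnum v k.+1 != 0).

Lemma qnumV n : qnum v^-1 n = - qnum v n.
Proof. by rewrite /qnum opprB exprVn invrK. Qed.

Let vV0 : v^-1 != 0. Proof. by rewrite invr_eq0. Qed.

Let qnV k : qnum v^-1 k.+1 != 0. Proof. by rewrite qnumV oppr_eq0. Qed.

Lemma hs_wpsV k : hs (wps v) k =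
  v ^ (k%:Z * (k%:Z - 1)) * (-1) ^+ k * hs (wps v^-1) k.
Proof.
elim: k => [|k IH]; first by rewrite !hs0 mul0r expr0z !mulr1.
rewrite !(hs_wpsS natF) // IH qnumV exprVn exprS.
have -> : v ^ (k.+1%:Z * (k.+1%:Z - 1)) = v ^ (k%:Z * (k%:Z - 1)) * (v ^+ k * v ^+ k).
  rewrite [v ^+ k]exprnP -!expfzDr //; congr (v ^ _); lia.
by field; rewrite oppr_eq0 qn expf_neq0.
Qed.

Lemma prod_exprz n (f : 'I_n -> int) : \prod_(i < n) v ^ f i = v ^ (\sum_(i < n) f i).
Proof. by rewrite (big_morph (fun z : int => v ^ z) (fun a b => expfzDr a b v0)
  (expr0z v)). Qed.

(** The staircase exponents left over in [sf_wps_inv]: for c = 0, ..., n - 1 the sums of 3c^2 and of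
    (2n - 1)c are both n(n - 1)(2n - 1)/2. *)
Lemma sum_delta_exponents n : \sum_(i < n)
  (3 * (n - i.+1)%N%:Z ^+ 2 - (2 * n%:Z - 1) * (n - i.+1)%N%:Z) = 0 :> int.
Proof.
rewrite (reindex_inj rev_ord_inj) /=.
under eq_bigr => i _ do rewrite subn_rev //.
suff sumE k : (\sum_(i < k) (3 * i%:Z ^+ 2 - (2 * n%:Z - 1) * i%:Z)) * 2 =
    k%:Z * (k%:Z - 1) * (2 * k%:Z - 1) - (2 * n%:Z - 1) * k%:Z * (k%:Z - 1) :> int.
  by apply: (@mulIf _ (2 : int)) => //; rewrite mul0r sumE; ring.
elim: k => [|k IH]; first by rewrite big_ord0; ring.
by rewrite big_ord_recr /= mulrDl IH intS; ring.
Qed.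

(** Both sides have a product formula, and z_j - z_i = - z_i z_j (1/z_j - 1/z_i) relates their
    Vandermonde factors. Since 1/[n] is odd under v -> 1/v, the right side is, up to sign, the
    function of the transpose: this is the origin of W_mu = q^(kappa_mu/2) W_(mu^t). *)
Lemma sf_wps_inv mu : sf (hs (wps v)) mu =
  v ^ (kappa mu) * ((-1) ^+ sumn mu * sf (hs (wps v^-1)) mu).
Proof.
rewrite /sf !(jt_wps natF) //; set n := size mu.
have zV i : zbeta v n mu i = v ^ (- (2 * beta n mu i)%N%:Z) by rewrite /zbeta exprnN.
have zV' i : zbeta v^-1 n mu i = v ^ (2 * beta n mu i)%N%:Z.
  by rewrite /zbeta exprVn invrK.
have zE i : zbeta v n mu i = (zbeta v^-1 n mu i)^-1 by rewrite /zbeta exprVn invrK.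
have z0 i : zbeta v^-1 n mu i != 0 by rewrite zV' expfz_neq0.
have -> : \prod_(i < n) \prod_(j < n | (i < j)%N) (zbeta v n mu j - zbeta v n mu i) =
    \prod_(i < n) ((- zbeta v n mu i) ^+ (n - i.+1) * zbeta v n mu i ^+ i) *
    \prod_(i < n) \prod_(j < n | (i < j)%N) (zbeta v^-1 n mu j - zbeta v^-1 n mu i).
  rewrite -(prod_ltn_split (fun i => - zbeta v n mu i)) -big_split.
  apply: eq_bigr => i _; rewrite -big_split; apply: eq_bigr => j _ /=.
  by rewrite !zE; field; rewrite !z0.
set D := \prod_(i < n) \prod_(j < n | (i < j)%N) _.
rewrite (eq_bigr _ (fun (i : 'I_n) _ => hs_wpsV (beta n mu i))) big_split /=.
have -> : \prod_(c < n) v^-1 ^+ (c * c) = \prod_(c < n) v ^ (- (c * c)%N%:Z).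
  by apply: eq_bigr => c _; rewrite exprVn exprnN.
rewrite [\prod_(c < n) v ^+ (c * c)](reindex_inj rev_ord_inj).
rewrite [\prod_(c < n) v ^ (- _)](reindex_inj rev_ord_inj) /=.
set H := \prod_(i < n) hs _ _.
suff main :
    \prod_(i < n) (v ^ ((beta n mu i)%:Z * ((beta n mu i)%:Z - 1)) * (-1) ^+ beta n mu i) *
    \prod_(i < n) v ^+ ((n - i.+1) * (n - i.+1)) *
    \prod_(i < n) ((- zbeta v n mu i) ^+ (n - i.+1) * zbeta v n mu i ^+ i) =
    v ^ kappa mu * (-1) ^+ sumn mu * \prod_(i < n) v ^ (- ((n - i.+1) * (n - i.+1))%N%:Z).
  have rearr (a b c d x y z : F) : a * b * c = x * y * z ->
      a * H * b * (c * d) = x * (y * (H * z * d)).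
    by move=> e; transitivity (a * b * c * (H * d)); [ring | rewrite e; ring].
  exact: rearr.
(* The terms [e i] add up to zero; inserting them into [kappa mu] makes the powers of [v] agree row
   by row. *)
pose e i : int := 3 * (n - i.+1)%N%:Z ^+ 2 - (2 * n%:Z - 1) * (n - i.+1)%N%:Z.
have -> : kappa mu = \sum_(i < n) ((nth 0%N mu i)%:Z *
    ((nth 0%N mu i)%:Z - (2 * i.+1)%N%:Z + 1) + e i).
  by rewrite big_split /= sum_delta_exponents addr0.
rewrite -(sumn_nth (leqnn n)) expr_sum -prod_exprz -!big_split.
apply: eq_bigr => i _ /=; rewrite zV [(- v ^ _) ^+ _]exprNn /e.
have bE : beta n mu i = (nth 0%N mu i + (n - i.+1))%N by [].
have nE : n%:Z = (n - i.+1)%N%:Z + i%:Z + 1 by have := ltn_ord i; lia.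
rewrite nE; move: (beta n mu i) (nth 0%N mu i) (n - i.+1)%N bE => b k c bE.
have sgnE : (-1) ^+ b * (-1) ^+ c = (-1) ^+ k :> F.
  by rewrite bE exprD -mulrA -exprD addnn -mul2n exprM sqrrN !expr1n mulr1.
have powE : v ^ (b%:Z * (b%:Z - 1)) * v ^+ (c * c) *
    ((v ^ (- (2 * b)%N%:Z)) ^+ c * (v ^ (- (2 * b)%N%:Z)) ^+ i) =
    v ^ (k%:Z * (k%:Z - (2 * i.+1)%N%:Z + 1) +
      (3 * c%:Z ^+ 2 - (2 * (c%:Z + i%:Z + 1) - 1) * c%:Z)) * v ^ (- (c * c)%N%:Z).
  rewrite -exprD ![_ ^+ _]exprnP exprz_exp -!expfzDr //; congr (v ^ _).
  rewrite bE !PoszM !intS !PoszD; ring.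
have rearr (x s y t p q z r : F) : x * y * (p * q) = z * r ->
    x * s * y * (t * p * q) = z * (s * t) * r.
  by move=> xyz; transitivity (x * y * (p * q) * (s * t)); [ring | rewrite xyz; ring].
by rewrite (rearr _ _ _ _ _ _ _ _ powE) sgnE.
Qed.

End Inversion.

Section Omega.

(** The power sums after the involution omega, p_n -> (-1)^(n-1) p_n. *)
Definition omega (R : comNzRingType) (p : nat -> R) n : R := - ((-1) ^+ n * p n).

Lemma qnum2_gt0 k : 0 < qnum (2 : rat) k.+1.
Proof.
have two : 1 < 2 ^+ k.+1 :> rat by rewrite exprn_egt1.
by rewrite subr_gt0 (lt_trans _ two) // invf_lt1 // (lt_trans ltr01 two).
Qed.

Let natR : forall k, k.+1%:R != 0 :> rat := @natF_num rat.

Lemma hs_wps2_gt0 k : 0 < hs (wps (2 : rat)) k.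
Proof.
elim: k => [|k IH]; first by rewrite hs0 ltr01.
rewrite (hs_wpsS natR) // => [|j]; last by rewrite gt_eqF ?qnum2_gt0.
by rewrite divr_gt0 ?mulr_gt0 ?exprn_gt0 ?qnum2_gt0.
Qed.

Lemma sf_wps2_gt0 mu : sorted geq mu -> 0 < sf (hs (wps (2 : rat))) mu.
Proof.
move=> mus; rewrite /sf (jt_wps natR) // => [|j]; last by rewrite gt_eqF ?qnum2_gt0.
rewrite !mulr_gt0 //; first by apply: prodr_gt0 => i _; exact: hs_wps2_gt0.
  by apply: prodr_gt0 => i _; rewrite exprn_gt0.
apply: prodr_gt0 => i _; apply: prodr_gt0 => j ij; rewrite subr_gt0.
rewrite ltf_pV2 ?posrE ?exprn_gt0 // ltr_eXn2l // ltn_mul2l /=.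
exact: (strict_beta mus (introT andP (conj ij (ltn_ord j)))).
Qed.

(* The sign is found by evaluating at p_n = 1/[n] and v = 2, where both sides
   are positive by the product formula. *)
Lemma sf_transposeN (R : comUnitRingType) (natU : forall k, k.+1%:R \is a @GRing.unit R)
    (p : nat -> R) mu : is_part mu ->
  sf (hs p) mu = (-1) ^+ sumn mu * sf (hs (fun n => - p n)) (transpose mu).
Proof.
move=> mup; have [b bE] := sf_transpose_sign mup.
suff signE : (-1) ^+ b = (-1) ^+ sumn mu :> rat.
  rewrite (bE R _ _ (hs0 p) (conv_hsN natU p)); congr (_ * _).
  by rewrite -[RHS]signr_odd; congr (_ ^+ nat_of_bool _); apply: (@signr_inj rat);
    rewrite signE signr_odd.
have natRU := @natU_num rat.
have [/andP[mus _] /andP[mus' _]] := (mup, is_part_transpose mup).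
have two0 : 2 != 0 :> rat by [].
have q0 k : qnum (2 : rat) k.+1 != 0 by rewrite gt_eqF ?qnum2_gt0.
have wV : forall k, (k <= sumn (transpose mu))%N ->
    hs (wps (2^-1 : rat)) k = hs (fun n => - wps (2 : rat) n) k.
  by move=> k; apply: (eq_hs natRU) => i _; rewrite /wps qnumV invrN.
have pos := sf_wps2_gt0 mus; have pos' := sf_wps2_gt0 mus'.
(* The value of s_(mu^t) at - w is positive after multiplication by either sign: [bE] turns s_mu(w)
   into one product, [sf_wps_inv] turns s_(mu^t)(w) into the other, up to a power of 2. *)
rewrite (bE rat _ _ (hs0 _) (conv_hsN natRU _)) in pos.
rewrite (sf_wps_inv natR two0 q0) (eq_sf wV) sumn_transpose // in pos'.
move: pos'; rewrite pmulr_rgt0 ?exprz_gt0 //; move: pos.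
set x := sf _ _; rewrite -(signr_odd _ (sumn mu)).
by case: b {bE} (odd _) => [] [] //=; rewrite !expr0 !expr1 !mul1r !mulN1r oppr_gt0 =>
  /lt_trans h /h; rewrite ltxx.
Qed.

Lemma sf_transpose (R : comUnitRingType) (natU : forall k, k.+1%:R \is a @GRing.unit R)
    (p : nat -> R) mu : is_part mu ->
  sf (hs p) (transpose mu) = sf (hs (omega p)) mu.
Proof.
move=> mup; rewrite (sf_transposeN natU (omega p) mup) -(sumn_transpose mup).
rewrite -sf_scale; apply: eq_sf => k kd; rewrite -(hs_scale natU).
apply: (eq_hs natU (n := k)) => // i _.
by rewrite /omega opprK mulrA -expr2 sqrr_sign mul1r.
Qed.

End Omega.

(** * Exponentials of power series *)

Section Truncation.

Context (K : fieldType) (n : nat).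
Implicit Types (P Q : {mpoly K[n]}) (f g : nat -> {mpoly K[n]}) (N b : nat).

Definition eqmod N P Q := forall m, (mdeg m < N)%N -> P@_m = Q@_m.

Lemma mcoeffM_lin N P Q m : (mdeg m < N)%N ->
  (P * Q)@_m = \sum_(k : 'X_{1..n < N} | (k <= m)%MM) P@_k * Q@_(m - k).
Proof. exact: mcoeff_poly_mul_lin. Qed.

Lemma eqmod_trans N P Q S : eqmod N P Q -> eqmod N Q S -> eqmod N P S.
Proof. by move=> PQ QS m mN; rewrite PQ // QS. Qed.

Lemma eqmodM N P P' Q Q' : eqmod N P P' -> eqmod N Q Q' -> eqmod N (P * Q) (P' * Q').
Proof.
move=> PP QQ m mN; rewrite !(mcoeffM_lin _ _ mN); apply: eq_bigr => k km.
rewrite PP ?QQ // (leq_ltn_trans _ mN) //; first exact: mdegB.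
by rewrite -(submK km) mdegD leq_addl.
Qed.

Definition ordge b P := forall m, (mdeg m < b)%N -> P@_m = 0.

Lemma ordge0 b : ordge b 0.
Proof. by move=> m _; rewrite mcoeff0. Qed.

Lemma ordge1 : ordge 0 1.
Proof. by []. Qed.

Lemma ordgeW b b' P : (b <= b')%N -> ordge b' P -> ordge b P.
Proof. by move=> bb oP m mb; rewrite oP // (leq_trans mb). Qed.

Lemma ordgeD b P Q : ordge b P -> ordge b Q -> ordge b (P + Q).
Proof. by move=> oP oQ m mb; rewrite mcoeffD oP ?oQ ?addr0. Qed.

Lemma ordgeN b P : ordge b P -> ordge b (- P).
Proof. by move=> oP m mb; rewrite mcoeffN oP ?oppr0. Qed.

Lemma ordgeZ b c P : ordge b P -> ordge b (c *: P).
Proof. by move=> oP m mb; rewrite mcoeffZ oP ?mulr0. Qed.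

Lemma ordge_sum b (I : Type) (r : seq I) (p : pred I) (F : I -> {mpoly K[n]}) :
  (forall i, p i -> ordge b (F i)) -> ordge b (\sum_(i <- r | p i) F i).
Proof. by move=> oF; apply: big_ind => //; [exact: ordge0 | exact: ordgeD]. Qed.

Lemma ordgeM b b' P Q : ordge b P -> ordge b' Q -> ordge (b + b') (P * Q).
Proof.
move=> oP oQ m mb; rewrite (mcoeffM_lin _ _ (ltnSn _)) big1 // => k km.
have dm : (mdeg k + mdeg (m - k) = mdeg m)%N by rewrite -mdegD addmC submK.
have [kb|bk] := ltnP (mdeg k) b; first by rewrite oP ?mul0r.
by rewrite oQ ?mulr0 //; lia.
Qed.

Lemma ordgeX i k : ordge k ('X_i ^+ k).
Proof.
move=> m mk; rewrite mpolyXn mcoeffX; case: eqP mk => // <-.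
by rewrite mdegMn mdeg1 mul1n ltnn.
Qed.

Definition tsum N f := \sum_(b < N) f b.

Lemma tsum_horner N f : tsum N f = (trunc_poly N f).[1].
Proof.
rewrite (@horner_coef_wide _ N); last exact: size_poly.
by apply: eq_bigr => b _; rewrite coef_poly ltn_ord expr1n mulr1.
Qed.

Lemma ordge_conv f g : (forall b, ordge b (f b)) -> (forall b, ordge b (g b)) ->
  forall b, ordge b (conv f g b).
Proof.
move=> of_ og b; apply: ordge_sum => i _.
by rewrite -{1}(subnKC (leq_ord i)); apply: ordgeM.
Qed.

(** Terms of index N or more in the product have order at least N and are invisible to [eqmod N].
    Reading [tsum] as a polynomial evaluated at 1 lets polynomial multiplication collect the
    terms. *)
Lemma tsum_conv N f g : (forall b, ordge b (f b)) -> (forall b, ordge b (g b)) ->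
  eqmod N (tsum N f * tsum N g) (tsum N (conv f g)).
Proof.
move=> of_ og m mN; rewrite !tsum_horner -hornerM.
set tf := trunc_poly N f; set tg := trunc_poly N g.
have ot (h : nat -> {mpoly K[n]}) : (forall b, ordge b (h b)) ->
    forall b, ordge b (trunc_poly N h)`_b.
  by move=> oh b; rewrite coef_poly; case: ifP => // _; exact: ordge0.
rewrite (@horner_coef_wide _ (N + N)); last first.
  rewrite (leq_trans (size_polyMleq _ _)) // (leq_trans (leq_pred _)) //.
  by rewrite leq_add ?size_poly.
rewrite (@horner_coef_wide _ N); last exact: size_poly.
rewrite big_split_ord mcoeffD /= [X in _ + X](_ : _ = 0) ?addr0; last first.
  rewrite raddf_sum big1 //= => b _; rewrite expr1n mulr1 conv_poly.
  by rewrite (ordge_conv (ot _ of_) (ot _ og)) // (leq_trans mN) // leq_addr.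
congr mcoeff; apply: eq_bigr => b _; rewrite !expr1n !mulr1.
by rewrite coef_poly ltn_ord (conv_trunc _ _ (ltn_ord b)).
Qed.

End Truncation.

Section Exponential.

Context (R : comUnitRingType) (natU : forall k, k.+1%:R \is a @GRing.unit R).
Implicit Types (phi f g : nat -> R).

Definition convpow phi k := iter k (conv phi) (@seq1 R).

Lemma conv_deriv f g N : N%:R * conv f g N =
  conv (fun i => i%:R * f i) g N + conv f (fun i => i%:R * g i) N.
Proof.
rewrite /conv mulr_sumr -big_split; apply: eq_bigr => i _.
rewrite -{1}(subnKC (leq_ord i)) natrD mulrDl; congr (_ + _); first by rewrite mulrA.
exact: mulrCA.
Qed.

Lemma convpow_deriv phi k N : N%:R * convpow phi k.+1 N =
  k.+1%:R * conv (fun i => i%:R * phi i) (convpow phi k) N.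
Proof.
elim: k N => [|k IH] N; rewrite [convpow _ _.+1]iterS -/(convpow _ _) conv_deriv.
  rewrite [X in _ + X](_ : _ = 0) ?addr0 ?mul1r // /conv big1 // => i _ /=.
  by rewrite /seq1; case: (N - i)%N => [|j]; rewrite ?mul0r ?mulr0.
have -> : conv phi (fun i => i%:R * convpow phi k.+1 i) N =
    k.+1%:R * conv (fun i => i%:R * phi i) (convpow phi k.+1) N.
  transitivity (k.+1%:R * conv phi (conv (fun i => i%:R * phi i) (convpow phi k)) N).
    by rewrite /conv mulr_sumr; apply: eq_bigr => i _; rewrite IH mulrCA.
  congr (_ * _); rewrite convA [RHS]convA; apply: eq_conv => // i _; exact: convC.
by rewrite -[k.+2]add1n natrD mulrDl mul1r.
Qed.

Lemma convpow_eq0 phi k N : phi 0%N = 0 -> (N < k)%N -> convpow phi k N = 0.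
Proof.
move=> phi0; elim: k N => // k IH N Nk; rewrite [convpow _ _]iterS -/(convpow _ _).
rewrite /conv big1 // => -[[|i] /= lt_i] _; first by rewrite phi0 mul0r.
rewrite [convpow _ _ _]IH ?mulr0 //; lia.
Qed.

(** The exponential E of [phi] satisfies D E = (D phi) E for the derivation D multiplying degree k
    by k. This is Newton's recursion, whose solution is unique. In degree N the sum stops at k = N
    because [phi] has no constant term. *)
Lemma hs_exp phi p : phi 0%N = 0 -> (forall k, k.+1%:R * phi k.+1 = p k.+1) ->
  forall N, hs p N = \sum_(k < N.+1) convpow phi k N / k`!%:R.
Proof.
move=> phi0 phip; pose E M N := \sum_(k < M) convpow phi k N / k`!%:R.
have EM M N : (N < M)%N -> E M N = E N.+1 N.
  move=> NM; rewrite /E (big_ord_widen M (fun k => convpow phi k N / k`!%:R) NM).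
  rewrite [RHS]big_mkcond; apply: eq_bigr => k _; case: ifP => // /negbT.
  by rewrite -leqNgt => Nk; rewrite convpow_eq0 ?mul0r.
move=> N; apply/esym/(newton_hsE natU (h := fun N => E N.+1 N)); split=> [|k].
  by rewrite /E big_ord1 divr1.
have DE i : i%:R * phi i = p i *+ (i != 0%N).
  by case: i => [|i]; rewrite ?mul0r // phip mulr1n.
transitivity (conv (fun i => i%:R * phi i) (E k) k); last first.
  apply: eq_bigr => -[[|i] lt_i] _ /=; first by rewrite !mul0r.
  rewrite DE (EM k) //; lia.
rewrite {1}/E big_ord_recl mulrDr.
have -> : k%:R * (convpow phi (@ord0 k) k / (@ord0 k)`!%:R) = 0.
  by rewrite [convpow _ _ _]/(seq1 R k) /seq1; case: (k) => [|k']; rewrite ?mul0r ?mulr0.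
rewrite add0r mulr_sumr.
transitivity (\sum_(i < k.+1) \sum_(j < k) i%:R * phi i * (convpow phi j (k - i)%N / j`!%:R)).
  rewrite exchange_big /=; apply: eq_bigr => j _.
  have jU : j`!%:R \is a @GRing.unit R by case: j`! (fact_gt0 j).
  rewrite mulrA convpow_deriv factS natrM invrM // mulrC -mulrA mulKr //.
  rewrite mulrC /conv mulr_suml; apply: eq_bigr => i _.
  exact/esym/mulrA.
by apply: eq_bigr => i _; rewrite mulr_sumr.
Qed.

End Exponential.

Section SeriesExp.

Context (K : fieldType) (natK : forall k, k.+1%:R != 0 :> K) (n : nat).
Implicit Types (f : 'X_{1..n} -> K) (P : {mpoly K[n]}).

Lemma series_mulE N f g P Q : (forall m, (mdeg m < N)%N -> f m = P@_m) ->
  (forall m, (mdeg m < N)%N -> g m = Q@_m) ->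
  forall m, (mdeg m < N)%N -> series_mul f g m = (P * Q)@_m.
Proof.
move=> fP gQ m mN; rewrite (mcoeffM_lin _ _ (ltnSn _)); apply: eq_bigr => k km.
rewrite fP ?gQ //; first by rewrite (leq_ltn_trans (mdegB _ _) mN).
by rewrite (leq_ltn_trans _ mN) // -ltnS bmdeg.
Qed.

Lemma series_powE N f P k : (forall m, (mdeg m < N)%N -> f m = P@_m) ->
  forall m, (mdeg m < N)%N -> series_pow f k m = (P ^+ k)@_m.
Proof.
move=> fP; elim: k => [|k IH] m mN; first by rewrite /series_pow /= expr0 mcoeff1.
by rewrite exprS -(series_mulE fP IH).
Qed.

Lemma tsum_convpow N (phi : nat -> {mpoly K[n]}) k : (forall b, ordge b (phi b)) ->
  eqmod N (tsum N phi ^+ k) (tsum N (convpow phi k)).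
Proof.
move=> ophi; have o1 b : ordge b (seq1 {mpoly K[n]} b).
  by case: b => [|b]; [exact: ordge1 | exact: ordge0].
have ocp j b : ordge b (convpow phi j b).
  by elim: j b => [|j IH] // b; exact: ordge_conv.
elim: k => [|k IH].
  rewrite expr0 => m; case: N => // N mN; rewrite /tsum big_ord_recl big1 ?addr0 //.
apply: (eqmod_trans (Q := tsum N phi * tsum N (convpow phi k))).
  by rewrite exprS; apply: eqmodM.
exact: tsum_conv.
Qed.

(* [p] is n times the coefficient of order n of the exponentiated series. *)
Lemma series_exp_hs N f (p : nat -> {mpoly K[n]}) : (forall b, ordge b (p b)) ->
  (forall m, (mdeg m < N)%N -> f m = \sum_(1 <= d < N) d%:R^-1 * (p d)@_m) ->
  forall m, (mdeg m < N)%N -> series_exp f m = (tsum N (hs p))@_m.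
Proof.
move=> op fp m mN; pose phi d : {mpoly K[n]} := d%:R^-1 *: p d *+ (d != 0%N).
have natM := natU_mpoly natK n.
have ophi b : ordge b (phi b).
  by rewrite /phi; case: eqP => _; [exact: ordge0 | apply: ordgeZ].
have fphi m' : (mdeg m' < N)%N -> f m' = (tsum N phi)@_m'.
  move=> mN'; rewrite fp // /tsum raddf_sum /= -(big_mkord xpredT (fun d => (phi d)@_m')).
  have N0 : (0 < N)%N by case: (N) mN'.
  rewrite [RHS]big_ltn //= {1}/phi mulr0n mcoeff0 add0r.
  rewrite !big_nat; apply: eq_bigr => d /andP[d0 _].
  by rewrite /phi -lt0n d0 mulr1n mcoeffZ.
have phiE k : k.+1%:R * phi k.+1 = p k.+1.
  by rewrite /phi mulr1n -mpolyC_nat mul_mpolyC scalerA mulfV ?scale1r.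
have phi0 : phi 0%N = 0 by rewrite /phi mulr0n.
have hsE := hs_exp natM phi0 phiE.
have cp0 k b : (b < k)%N -> convpow phi k b = 0 by exact: convpow_eq0.
transitivity (\sum_(k < N) (tsum N (convpow phi k))@_m / k`!%:R).
  rewrite /series_exp (big_ord_widen N (fun k => series_pow f k m / k`!%:R) mN).
  rewrite big_mkcond; apply: eq_bigr => k _; case: ifP => [_|/negbT].
    by rewrite (series_powE k fphi mN) (tsum_convpow k ophi mN).
  rewrite -leqNgt => mk; rewrite -(tsum_convpow k ophi mN).
  rewrite (_ : _@_m = 0) ?mul0r //.
  have : ordge k (tsum N phi ^+ k).
    elim: (k : nat) => [|j IH]; first exact: ordge1.
    rewrite exprS -add1n; apply: ordgeM => //; apply: ordge_sum => -[[|i] lt_i] _ /=.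
      by rewrite phi0; exact: ordge0.
    by apply: (ordgeW _ (ophi _)).
  by apply; exact: mk.
rewrite /tsum raddf_sum /=.
under eq_bigr do rewrite raddf_sum mulr_suml.
rewrite exchange_big /=; apply: eq_bigr => b _; rewrite hsE raddf_sum /=.
rewrite [RHS](big_ord_widen N (fun k => (convpow phi k b / k`!%:R)@_m) (ltn_ord b)).
rewrite [RHS]big_mkcond; apply: eq_bigr => k _; case: ifP => [_|/negbT].
  rewrite -[_%:R in RHS]mpolyC_nat -rmorphV /=; last first.
    by rewrite unitfE; case: k`! (fact_gt0 k).
  by rewrite [in RHS]mulrC mul_mpolyC mcoeffZ mulrC.
by rewrite -leqNgt => bk; rewrite cp0 // mcoeff0 mul0r.
Qed.

End SeriesExp.

Section ExpQ.

Context (K : fieldType) (natK : forall k, k.+1%:R != 0 :> K) (v : K).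
Hypotheses (qn : forall k, qnum v k.+1 != 0).

(** [Qps n] divided by n is the n-th summand of the exponent, so [hs Qps] is the graded exponential
    of the series. *)
Definition Qps n : {mpoly K[3]} := (- wps v n ^+ 2) *: Qpoly K n.

Lemma ordge_Qps n : ordge n (Qps n).
Proof.
apply: ordgeZ; rewrite /Qpoly; have oX i : ordge n ('X_i ^+ n : {mpoly K[3]}) by exact: ordgeX.
have oM P Q : ordge n P -> ordge n Q -> ordge n (P * Q : {mpoly K[3]}).
  by move=> oP oQ; apply: ordgeW (leq_addr n n) _; exact: ordgeM.
by repeat first [exact: oX | apply/oM | apply: ordgeN | apply: ordgeD].
Qed.

Lemma series_exp_Qseries (m : 'X_{1..3}) N : (mdeg m < N)%N ->
  series_exp (Qseries v) m = (tsum N (hs Qps))@_m.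
Proof.
move: m; apply: (series_exp_hs natK ordge_Qps) => m mN; rewrite /Qseries.
rewrite [RHS](big_cat_nat (n := (mdeg m).+1)) //= [X in _ + X]big_nat [X in _ + X]big1 ?addr0.
  rewrite !big_nat; apply: eq_bigr => d /andP[d0 _].
  case: d d0 => // d _; rewrite mcoeffZ /wps invrN invfM exprVn; ring.
by move=> d /andP[md _]; rewrite ordge_Qps ?mulr0.
Qed.

End ExpQ.

(** * Topological vertex sums *)

Section Vertex.

Context (K : numClosedFieldType) (v : K) (v0 : v != 0) (qn : forall k, qnum v k.+1 != 0).
Implicit Types (mu nu rho lam tau : seq nat) (p : nat -> K).

Let natK := @natF_num K.
Let natU := @natU_num K.
Local Notation w := (wps v).
Local Notation W := (Wpart v).

Lemma Wpart_wps mu : is_part mu -> W mu = sf (hs w) mu.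
Proof. exact: Wpart_sf. Qed.

Lemma Wpart_transpose mu : is_part mu -> W (transpose mu) = sf (hs (omega w)) mu.
Proof. by move=> mup; rewrite Wpart_wps ?is_part_transpose // sf_transpose. Qed.

Lemma Wpart_neq0 mu : is_part mu -> W mu != 0.
Proof. by move=> mup; rewrite Wpart_wps //; apply: sf_wps_neq0 => //; case/andP: mup. Qed.

Lemma sf_scale_ps c p mu : sf (hs (fun n => c ^+ n * p n)) mu = c ^+ sumn mu * sf (hs p) mu.
Proof. by rewrite -sf_scale; apply: eq_sf => k _; rewrite hs_scale. Qed.

Lemma sf_opp p mu : sf (hs (fun n => - p n)) mu = (-1) ^+ sumn mu * sf (hs (omega p)) mu.
Proof.
rewrite -sf_scale_ps; apply: eq_sf => k _; apply: (eq_hs natU (n := k)) => // i _.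
by rewrite /omega mulrN mulrA -expr2 sqrr_sign mul1r.
Qed.

Lemma Wpart_kappa mu : is_part mu -> v ^ (kappa mu) * W (transpose mu) = W mu.
Proof.
move=> mup; rewrite (Wpart_wps mup) (sf_wps_inv natK) // Wpart_transpose //; congr (_ * _).
have -> : sf (hs (wps v^-1)) mu = sf (hs (fun n => - w n)) mu.
  by apply: eq_sf => k _; apply: (eq_hs natU (n := k)) => // i _; rewrite /wps qnumV invrN.
by rewrite (sf_opp w) mulrA -expr2 sqrr_sign mul1r.
Qed.

(** Applying [Wpart_kappa] to [mu] and to its transpose multiplies a nonzero W by this product and
    returns it unchanged. *)
Lemma kappa_transpose mu : is_part mu -> v ^ (kappa (transpose mu)) * v ^ (kappa mu) = 1.
Proof.
move=> mup; apply: (mulIf (Wpart_neq0 (is_part_transpose mup))).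
by have := Wpart_kappa (is_part_transpose mup);
  rewrite transposeK // -mulrA Wpart_kappa // mul1r.
Qed.

Lemma big_upto N (f : seq nat -> K) :
  \sum_(lam <- partitions_upto N) f lam = \sum_(j < N.+1) \sum_(lam <- partitions j) f lam.
Proof.
rewrite /partitions_upto big_flatten big_map.
rewrite -(big_mkord xpredT (fun j => \sum_(lam <- partitions j) f lam)).
by rewrite /index_iota subn0.
Qed.

Lemma big_ord_bound (M N : nat) (f : nat -> K) :
  (forall j, (M < j)%N -> f j = 0) -> (forall j, (N < j)%N -> f j = 0) ->
  \sum_(j < M.+1) f j = \sum_(j < N.+1) f j.
Proof.
wlog MN : M N / (M <= N)%N.
  by move=> th; case: (leqP M N) => [|/ltnW] ? ? ?; [apply: th | apply/esym/th].
move=> fM _; rewrite (big_ord_widen N.+1 f) // [LHS]big_mkcond; apply: eq_bigr => j _.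
by case: ltnP => // /fM ->.
Qed.

Lemma LR_size i j b lam tau mu : lam \in partitions i -> tau \in partitions j ->
  mu \in partitions b -> (i + j != b)%N -> LR lam tau mu = 0.
Proof.
move=> /partP[lamp <- _] /partP[taup <- _] /partP[_ mub _] ijb.
by apply: LR_out => //; apply: contra ijb => /partP[_ <- _]; rewrite mub.
Qed.

Lemma Wskew_sum b j mu lam : mu \in partitions b -> lam \in partitions j ->
  Wskew v mu lam = if (j <= b)%N
    then \sum_(tau <- partitions (b - j)) ratr (LR lam tau mu) * sf (hs w) tau else 0.
Proof.
move=> mub lamj; have [mup mubE _] := partP mub; rewrite /Wskew big_upto mubE.
case: leqP => jb; last first.
  rewrite big1 // => i _; rewrite big_seq big1 // => tau taui.
  by rewrite (LR_size lamj taui mub) ?rmorph0 ?mul0r //; lia.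
have lt_bj : (b - j < b.+1)%N by rewrite ltnS leq_subr.
rewrite (bigD1 (Ordinal lt_bj)) //= [X in _ + X]big1 ?addr0 => [|i ibj].
  by apply: eq_big_seq => tau /partP[taup _ _]; rewrite Wpart_wps.
rewrite big_seq big1 // => tau taui; rewrite (LR_size lamj taui mub) ?rmorph0 ?mul0r //.
by apply: contra ibj => /eqP e; rewrite -val_eqE /=; lia.
Qed.

(* The coefficient of Q^i in s_mu evaluated at p_n = (1 - Q^n) / [n]. *)
Definition Bcoef mu i : K :=
  (-1) ^+ i * \sum_(lam <- partitions i) Wskew v mu lam * W (transpose lam).

Lemma Bcoef_eq0 b mu i : mu \in partitions b -> (b < i)%N -> Bcoef mu i = 0.
Proof.
move=> mub bi; rewrite /Bcoef big_seq big1 ?mulr0 // => lam lami.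
by rewrite (Wskew_sum mub lami) leqNgt bi mul0r.
Qed.

(** The power sums split as w_n + x^n (- w_n), so [sf_coproduct] applies; the sign of w turns s_lam
    into (-1)^|lam| W_(lam^t). *)
Lemma Bcoef_sum b mu (x : K) : mu \in partitions b ->
  \sum_(i < b.+1) Bcoef mu i * x ^+ i = sf (hs (fun n => w n * (1 - x ^+ n))) mu.
Proof.
move=> mub; transitivity (sf (hs (fun n => x ^+ n * - w n + w n)) mu); last first.
  by apply: eq_sf => k _; apply: (eq_hs natU (n := k)) => // i _; ring.
rewrite -(sf_coproduct _ _ mub); apply: eq_bigr => i _.
rewrite /Bcoef mulrAC mulr_sumr; apply: eq_big_seq => lam lami.
have [lamp lamE _] := partP lami.
rewrite (Wskew_sum mub lami) leq_ord mulr_suml mulr_sumr; apply: eq_bigr => tau _.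
rewrite sf_scale_ps (sf_opp w) Wpart_transpose // lamE; ring.
Qed.

Local Notation G := (hs (fun n => - w n ^+ 2)).
Local Notation H := (hs (fun n => w n ^+ 2)).

Lemma hs_omega_sq k : hs (fun n => w n * omega w n) k = (-1) ^+ k * G k.
Proof.
rewrite -(hs_scale natU); apply: (eq_hs natU (n := k)) => // i _; rewrite /omega; ring.
Qed.

Definition pair_sum nu d : K := \sum_(rho <- partitions d) W (transpose rho) * Wpair v nu rho.

(** The factor q^(kappa_rho/2) changes W_(rho^t) into W_rho. Replacing rho by its transpose, the
    Littlewood-Richardson rule at [omega w] splits the sum over rho, and the Cauchy identity for w
    and [omega w] yields [G]. *)
Lemma pair_sumE b d mu : mu \in partitions b ->
  (-1) ^+ d * pair_sum mu d =
  v ^ (kappa mu) * \sum_(j < d.+1) Bcoef (transpose mu) j * G (d - j)%N.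
Proof.
move=> mub; have [mup mubE _] := partP mub; have mub' := transpose_partitions mub.
pose S j d' := \sum_(lam <- partitions j) Wskew v (transpose mu) lam *
  \sum_(rho <- partitions d') W (transpose rho) * Wskew v rho lam.
have -> : pair_sum mu d = v ^ (kappa mu) * \sum_(j < b.+1) S j d.
  rewrite /pair_sum (eq_big_seq (fun rho => v ^ (kappa mu) *
    (\sum_(lam <- partitions_upto (sumn mu))
      Wskew v (transpose mu) lam * (W rho * Wskew v (transpose rho) lam)))) => [|rho rhod];
    last first.
    have [rhop _ _] := partP rhod.
    rewrite /Wpair expfzDr // -(Wpart_kappa rhop).
    set X := v ^ kappa mu; set Y := v ^ kappa rho; set Z := W (transpose rho).
    rewrite mulrA (_ : Z * (X * Y) = X * (Y * Z)); last by ring.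
    by rewrite -mulrA; congr (_ * _); rewrite mulr_sumr; apply: eq_bigr => lam _;
      rewrite mulrCA.
  rewrite -mulr_sumr exchange_big big_upto mubE /=; congr (_ * _).
  apply: eq_bigr => j _; apply: eq_bigr => lam _; rewrite -mulr_sumr; congr (_ * _).
  rewrite -(big_transpose d (fun rho => W (transpose rho) * _)).
  by apply: eq_big_seq => rho /partP[rhop _ _]; rewrite transposeK.
(* A skew function vanishes when the inner partition is the larger one, so only j <= min(b, d)
   contributes and the cutoffs are interchangeable. *)
rewrite (@big_ord_bound b d (S ^~ d)) /S => [|j bj|j dj]; last first.
- rewrite big_seq big1 // => lam lamj.
  rewrite [X in _ * X]big_seq [X in _ * X]big1 ?mulr0 // => rho rhod.
  by rewrite (Wskew_sum rhod lamj) leqNgt dj mulr0.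
- by rewrite big_seq big1 // => lam lamj; rewrite (Wskew_sum mub' lamj) leqNgt bj mul0r.
rewrite mulrCA mulr_sumr; congr (_ * _); apply: eq_bigr => j _.
have jd := leq_ord j; rewrite /Bcoef -{1}(subnKC jd) exprD -!mulrA; congr (_ * _).
rewrite mulr_sumr mulr_suml; apply: eq_big_seq => lam lamj; have [lamp lamE _] := partP lamj.
rewrite mulrCA -mulrA; congr (_ * _).
rewrite (eq_big_seq (fun rho => \sum_(tau <- partitions (d - j))
    sf (hs w) tau * (ratr (LR lam tau rho) * sf (hs (omega w)) rho))) => [|rho rhod];
      last first.
  have [rhop _ _] := partP rhod.
  rewrite (Wskew_sum rhod lamj) jd Wpart_transpose // mulr_sumr; apply: eq_bigr => tau _; ring.
rewrite exchange_big /= (eq_big_seq (fun tau => sf (hs (omega w)) lam *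
    (sf (hs w) tau * sf (hs (omega w)) tau))) => [|tau taudj]; last first.
  have [taup tauE _] := partP taudj.
  rewrite -mulr_sumr mulrCA; congr (_ * _); rewrite -sf_LR // lamE tauE subnKC //.
rewrite -mulr_sumr cauchy hs_omega_sq Wpart_transpose // mulrCA; congr (_ * _).
by rewrite mulrA -expr2 sqrr_sign mul1r.
Qed.

(** The W of transposes are values at [omega w], where the rule sums c^mu_(rho rho1) W_(mu^t) over
    mu to W_(rho^t) W_(rho1^t). *)
Lemma LR_pair_sum a k rho nu : rho \in partitions k ->
  \sum_(rho1 <- partitions_upto a) \sum_(mu <- partitions a)
    ratr (LR rho rho1 mu) * W (transpose mu) * Wpair v nu rho1 =
  if (k <= a)%N then W (transpose rho) * pair_sum nu (a - k) else 0.
Proof.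
move=> rhok; have [rhop rhoE _] := partP rhok; rewrite big_upto.
have zero i : (k + i != a)%N -> \sum_(rho1 <- partitions i) \sum_(mu <- partitions a)
    ratr (LR rho rho1 mu) * W (transpose mu) * Wpair v nu rho1 = 0.
  move=> ka; rewrite big_seq big1 // => rho1 rho1i; rewrite big_seq big1 // => mu mua.
  by rewrite (LR_size rhok rho1i mua) // rmorph0 !mul0r.
case: leqP => ka; last by rewrite big1 // => i _; apply: zero; lia.
have lt_ak : (a - k < a.+1)%N by rewrite ltnS leq_subr.
rewrite (bigD1 (Ordinal lt_ak)) //= [X in _ + X]big1 ?addr0 => [|i iak]; last first.
  by apply: zero; apply: contra iak => /eqP e; rewrite -val_eqE /=; lia.
rewrite /pair_sum mulr_sumr; apply: eq_big_seq => rho1 /partP[rho1p rho1E _].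
rewrite -mulr_suml mulrA; congr (_ * _);
  rewrite !Wpart_transpose // -sf_LR // rhoE rho1E subnKC //.
by apply: eq_big_seq => mu /partP[mup _ _]; rewrite Wpart_transpose.
Qed.

Lemma sum_rearrange (I : Type) (r1 r3 s s1 s3 : seq I) (c : K) (f g : I -> I -> I -> K) :
  \sum_(m1 <- r1) \sum_(m3 <- r3) \sum_(x <- s) \sum_(x1 <- s1) \sum_(x3 <- s3)
    c * (f x x1 m1 * g x x3 m3) =
  \sum_(x <- s) c * ((\sum_(x1 <- s1) \sum_(m1 <- r1) f x x1 m1) *
    (\sum_(x3 <- s3) \sum_(m3 <- r3) g x x3 m3)).
Proof.
transitivity (\sum_(m1 <- r1) \sum_(m3 <- r3) \sum_(x <- s)
    c * ((\sum_(x1 <- s1) f x x1 m1) * (\sum_(x3 <- s3) g x x3 m3))).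
  apply: eq_bigr => m1 _; apply: eq_bigr => m3 _; apply: eq_bigr => x _.
  rewrite mulr_suml mulr_sumr; apply: eq_bigr => x1 _.
  by rewrite !mulr_sumr.
under eq_bigr do rewrite exchange_big /=.
rewrite exchange_big /=; apply: eq_bigr => x _.
rewrite [X in _ = _ * (X * _)]exchange_big [X in _ = _ * (_ * X)]exchange_big /=.
rewrite mulr_suml mulr_sumr.
apply: eq_bigr => m1 _; rewrite !mulr_sumr; apply: eq_bigr => m3 _.
by [].
Qed.

(** For fixed mu2 the sums over mu1 and mu3 are coupled only by the common [rho], of size k. Each
    becomes W_(rho^t) times a pair sum, and the squares of W_(rho^t) add up to [H k]. *)
Lemma Z1_expand (m : 'X_{1..3}) : Z1 v m =
  \sum_(k < (m i0).+1) if (k <= m i2)%N then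
     H k * ((-1) ^+ m i1 * \sum_(mu <- partitions (m i1))
       (\sum_(i < (m i0 - k).+1) Bcoef mu i * G (m i0 - k - i)%N) *
       (\sum_(j < (m i2 - k).+1) Bcoef (transpose mu) j * G (m i2 - k - j)%N))
  else 0.
Proof.
rewrite /Z1; move: (m i0) (m i1) (m i2) => a b c.
pose X rho d nu : K := \sum_(rho1 <- partitions_upto d) \sum_(mu <- partitions d)
    ratr (LR rho rho1 mu) * W (transpose mu) * Wpair v nu rho1.
transitivity (\sum_(mu <- partitions b) \sum_(rho <- partitions_upto a)
   (-1) ^+ (a + b + c) * (X rho a (transpose mu) * X rho c mu)).
  rewrite exchange_big /=; apply: eq_big_seq => mu2 mu2b; have [mu2p mu2E _] := partP mu2b.
  rewrite -sum_rearrange; apply: eq_big_seq => mu1 mu1a; have [_ mu1E _] := partP mu1a.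
  rewrite -[RHS]big_transpose; apply: eq_big_seq => mu3 mu3c; have [mu3p mu3E _] := partP mu3c.
  rewrite /Wtriple mu1E mu2E mu3E transposeK // -(Wpart_kappa mu3p) expfzDr //.
  (* The denominator of the vertex is cancelled by the weight and the framing factor of mu2. *)
  have ratio : v ^ kappa mu2 * W (transpose mu2) / W mu2 = 1.
    by rewrite Wpart_kappa // mulfV // Wpart_neq0.
  rewrite [LHS]mulrAC mulr_sumr; apply: eq_bigr => rho _.
  rewrite mulr_sumr; apply: eq_bigr => rho1 _.
  rewrite mulr_sumr; apply: eq_bigr => rho3 _.
  set L1 := ratr _; set L3 := ratr _; set P1 := Wpair _ _ _; set P3 := Wpair _ _ _.
  set W1 := W (transpose mu1); set W3 := W (transpose mu3); set k3 := v ^ kappa mu3.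
  transitivity ((v ^ kappa mu2 * W (transpose mu2) / W mu2) *
    ((-1) ^+ (a + b + c) * (L1 * W1 * P1 * (L3 * (k3 * W3) * P3)))); last first.
    by rewrite ratio mul1r.
  by rewrite !exprD; ring.
transitivity (\sum_(k < a.+1) \sum_(mu <- partitions b) \sum_(rho <- partitions k)
   (-1) ^+ (a + b + c) * (X rho a (transpose mu) * X rho c mu)).
  by rewrite [RHS]exchange_big; apply: eq_bigr => mu _; rewrite big_upto.
apply: eq_bigr => k _; have ka := leq_ord k; case: leqP => kc; last first.
  rewrite big1 // => mu _; rewrite big_seq big1 // => rho rhok.
  by rewrite /X (LR_pair_sum c _ rhok) leqNgt kc !mulr0.
rewrite !mulr_sumr; apply: eq_big_seq => mu mub; have [mup _ _] := partP mub.
have -> : H k = \sum_(rho <- partitions k) W (transpose rho) * W (transpose rho).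
  rewrite (eq_big_seq (fun rho => sf (hs (omega w)) rho * sf (hs (omega w)) rho)) =>
    [|rho /partP[rhop _ _]].
    rewrite cauchy; apply: (eq_hs natU (n := k)) => // i _.
    by rewrite /omega mulrNN mulrACA -expr2 sqrr_sign mul1r expr2.
  by rewrite Wpart_transpose.
rewrite mulr_suml; apply: eq_big_seq => rho rhok.
rewrite /X !(LR_pair_sum _ _ rhok) ka kc.
have := pair_sumE (a - k) (transpose_partitions mub); rewrite transposeK //.
have := pair_sumE (c - k) mub.
set U := \sum_(j < _) _ => e1; set V := \sum_(j < _) _ => e2.
have sgnE : (-1) ^+ (a + b + c) = (-1) ^+ b * ((-1) ^+ (a - k) * (-1) ^+ (c - k)) :> K.
  rewrite -!exprD -[LHS]signr_odd -[RHS]signr_odd; congr (_ ^+ nat_of_bool _).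
  by rewrite !oddD !oddB //; case: (odd a); case: (odd b); case: (odd c); case: (odd k).
set T := W (transpose rho); set p1 := pair_sum (transpose mu) _ in e2 *;
  set p2 := pair_sum mu _ in e1 *.
transitivity (T * T * ((-1) ^+ b * (((-1) ^+ (a - k) * p1) * ((-1) ^+ (c - k) * p2)))).
  by rewrite sgnE; ring.
(* The two pair sums belong to [mu] and its transpose, so their framing factors are inverse to each
   other. *)
rewrite e1 e2; congr (_ * (_ * _)); rewrite mulrACA kappa_transpose // mul1r //.
Qed.

End Vertex.

(** * Polynomial identities deduced from their values *)

Lemma digits_inj B n (f g : nat -> nat) :
  (forall i, (i < n)%N -> (f i < B)%N && (g i < B)%N) ->
  (\sum_(i < n) f i * B ^ i = \sum_(i < n) g i * B ^ i)%N ->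
  forall i, (i < n)%N -> f i = g i.
Proof.
elim: n f g => // n IH f g fgB; rewrite !big_ord_recl !expn0 !muln1 => e.
have split_sum (h : nat -> nat) :
    (\sum_(i < n) h (bump 0 i) * B ^ bump 0 i = B * \sum_(i < n) h i.+1 * B ^ i)%N.
  by rewrite big_distrr; apply: eq_bigr => i _; rewrite /bump leq0n add1n expnS mulnCA.
rewrite !split_sum in e.
have /andP[f0 g0] := fgB 0%N isT.
have B0 : (0 < B)%N by rewrite (leq_ltn_trans _ f0).
have e0 : f 0%N = g 0%N.
  by have := congr1 (modn ^~ B) e; rewrite ![(_ + B * _)%N]addnC ![(B * _)%N]mulnC;
    rewrite !modnMDl !modn_small.
case=> [//|i] lt_in; apply: (IH (fun i => f i.+1) (fun i => g i.+1)) => // [j jn|];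
  first exact: fgB.
by move: e; rewrite e0 => /addnI /eqP; rewrite eqn_pmul2l // => /eqP.
Qed.

(* Kronecker substitution reduces to univariate polynomials. *)
Lemma mpoly_eval_eq0 (K : numFieldType) n (P : {mpoly K[n]}) :
  (forall x : 'I_n -> K, P.@[x] = 0) -> P = 0.
Proof.
move=> P0; pose B := msize P.
pose code (m : 'X_{1..n}) := (\sum_(i < n) nth 0 m i * B ^ i)%N.
have code_inj : {in msupp P &, injective code}.
  move=> m m' mP mP' e; apply/mnmP=> i; rewrite !(mnm_nth 0%N).
  apply: (digits_inj (B := B) _ e) (ltn_ord i) => j jn.
  have lt_B (k : 'X_{1..n}) : k \in msupp P -> (nth 0%N k j < B)%N.
    move=> /msize_mdeg_lt; apply: leq_ltn_trans.
    by rewrite mdegE (bigD1 (Ordinal jn)) //= (mnm_nth 0%N) leq_addr.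
  by rewrite !lt_B.
pose p : {poly K} := \sum_(m <- msupp P) P@_m *: 'X^(code m).
have p_eval t : p.[t] = 0.
  rewrite -(P0 (fun i : 'I_n => t ^+ (B ^ i))) mevalE horner_sum; apply: eq_bigr => m _.
  rewrite hornerZ hornerXn /code expr_sum; congr (_ * _); apply: eq_bigr => i _.
  by rewrite -exprM mulnC (mnm_nth 0%N).
have p0 : p = 0.
  apply/eqP/negPn/negP => pn0.
  have := @max_poly_roots _ p [seq i%:R | i <- iota 0 (size p)] pn0.
  rewrite size_map size_iota ltnn => H.
  suff : false by []; apply: H; first by apply/allP => x _; apply/rootP.
  by rewrite map_inj_uniq ?iota_uniq // => i j /eqP; rewrite eqr_nat => /eqP.
apply/mpolyP => m; rewrite mcoeff0.
have [mP|/memN_msupp_eq0//] := boolP (m \in msupp P).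
have := congr1 (fun q : {poly K} => q`_(code m)) p0.
rewrite coef0 coef_sum (bigD1_seq m) ?msupp_uniq //= coefZ coefXn eqxx mulr1.
rewrite big_seq_cond big1 ?addr0 // => m' /andP[mP' mm'].
rewrite coefZ coefXn; case: eqP => [/esym/code_inj e|]; last by rewrite mulr0.
by case/eqP: mm'; apply: e.
Qed.

(** * Factorization of the partition function into four series *)

Section FinalAssembly.

Context (K : numClosedFieldType) (v : K) (v0 : v != 0) (qn : forall k, qnum v k.+1 != 0).

Let natK := @natF_num K.
Let natU := @natU_num K.
Let natM := natU_mpoly natK 3.
Local Notation w := (wps v).
Local Notation G := (hs (fun n => - w n ^+ 2)).
Local Notation H := (hs (fun n => w n ^+ 2)).
Local Notation A := {mpoly K[3]}.
Local Notation x := ('X_i0 : A).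
Local Notation y := ('X_i1 : A).
Local Notation z := ('X_i2 : A).

(** The terms with |mu| = b in the remaining sum over mu, with the power of e^(-t_2) removed;
    [Bcoef] vanishes beyond degree b. *)
Definition Rsum b : A := (-1) ^+ b *: \sum_(mu <- partitions b)
  (\sum_(i < b.+1) Bcoef v mu i *: x ^+ i) *
  (\sum_(j < b.+1) Bcoef v (transpose mu) j *: z ^+ j).

Definition Rps n : A := - w n ^+ 2 *: ((1 - x ^+ n) * (1 - z ^+ n)).

(** The Cauchy identity is available for values in the closed field, so both polynomials are
    compared at every point. There the transpose in the second factor becomes [omega], and its signs
    combine with (-1)^b. *)
Lemma Rsum_hs b : Rsum b = hs Rps b.
Proof.
apply/eqP; rewrite -subr_eq0; apply/eqP/mpoly_eval_eq0 => t.
apply/eqP; rewrite mevalB subr_eq0; apply/eqP.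
pose pt n := - (w n * (1 - t i0 ^+ n) * (w n * (1 - t i2 ^+ n))).
transitivity (hs pt b); last first.
  apply/esym; apply: (newton_uniq natU (newton_morph (meval t) (newton_hs natM Rps))
    (newton_hs natU pt) (n := b)) => // n _.
  rewrite /= /Rps mevalZ mevalM !mevalB !meval1 !rmorphXn /= !mevalXU /pt; ring.
rewrite /Rsum mevalZ raddf_sum /=.
transitivity ((-1) ^+ b *
    hs (fun n => w n * (1 - t i0 ^+ n) * omega (fun n => w n * (1 - t i2 ^+ n)) n) b).
  congr (_ * _); rewrite -cauchy; apply: eq_big_seq => mu mub; have [mup _ _] := partP mub.
  rewrite mevalM !raddf_sum /=; congr (_ * _).
    by rewrite -(Bcoef_sum v0 _ mub); apply: eq_bigr => i _; rewrite mevalZ rmorphXn /= mevalXU.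
  rewrite -sf_transpose // -(Bcoef_sum v0 _ (transpose_partitions mub)).
  by apply: eq_bigr => i _; rewrite mevalZ rmorphXn /= mevalXU.
rewrite -(hs_scale natU); apply: (eq_hs natU (n := b)) => // n _.
rewrite /omega /pt; set a := w n * _; set c := w n * _.
have -> : (-1) ^+ n * (a * - ((-1) ^+ n * c)) = - ((-1) ^+ n * (-1) ^+ n * (a * c)) by ring.
by rewrite -expr2 sqrr_sign mul1r.
Qed.

Local Notation N_x u := (horner_alg x u).
Local Notation N_z u := (horner_alg z u).

Lemma horner_alg_sum (X : A) (u : {poly K}) :
  horner_alg X u = \sum_(i < size u) u`_i *: X ^+ i.
Proof.
rewrite -{1}[u]coefK poly_def raddf_sum; apply: eq_bigr => i _.
by rewrite /= -mul_polyC rmorphM rmorphXn /= horner_algC horner_algX mulr_algl.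
Qed.

Lemma mcoeff_xyz (u t : {poly K}) b (m : 'X_{1..3}) :
  (N_x u * y ^+ b * N_z t)@_m = u`_(m i0) * (b == m i1)%:R * t`_(m i2).
Proof.
have coef_pick (q : {poly K}) d : q`_d = \sum_(i < size q) q`_i * (i == d :> nat)%:R.
  rewrite -[in LHS](coefK q) poly_def coef_sum; apply: eq_bigr => i _.
  by rewrite coefZ coefXn eq_sym.
rewrite !horner_alg_sum (coef_pick u) (coef_pick t) mulr_suml mulr_suml raddf_sum /=.
rewrite -mulrA mulr_suml; apply: eq_bigr => i _.
rewrite mulr_sumr raddf_sum /= !mulr_sumr; apply: eq_bigr => j _.
rewrite -!scalerAl -scalerAr !mcoeffZ !mpolyXn -!mpolyXD mcoeffX.
have -> : ((U_(i0) *+ i + U_(i1) *+ b + U_(i2) *+ j)%MM == m) =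
    [&& i == m i0 :> nat, b == m i1 & j == m i2 :> nat].
  apply/eqP/and3P => [<-|[/eqP e0 /eqP e1 /eqP e2]].
    by rewrite !mnmDE !mulmnE !mnm1E /= !mul1n !mul0n !addn0 !add0n.
  apply/mnmP => l; rewrite !mnmDE !mulmnE !mnm1E e0 e1 e2.
  by case: l => [[|[|[|l]]] lt_l] //=; rewrite ?mul1n ?mul0n ?addn0 ?add0n; congr (m _);
    apply: val_inj.
by rewrite -!mulnb !natrM; ring.
Qed.

Definition gpoly N : {poly K} := \poly_(i < N) G i.
Definition Bpoly b mu : {poly K} := \poly_(i < b.+1) Bcoef v mu i.

Lemma coef_XGB N k b mu a : (a < N)%N -> mu \in partitions b ->
  ('X^k * (Bpoly b mu * gpoly N))`_a = if (k <= a)%N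
    then \sum_(i < (a - k).+1) Bcoef v mu i * G (a - k - i)%N else 0.
Proof.
move=> aN mub; rewrite coefXnM ltnNge; case: leqP => //= ka.
rewrite coefM; apply: eq_bigr => i _.
rewrite !coef_poly ltnS (leq_ltn_trans _ aN) ?(leq_trans (leq_subr _ _)) ?leq_subr //.
by case: leqP => // bi; rewrite (Bcoef_eq0 v0 mub bi).
Qed.

(** The sums over i and j in [Z1_expand] are coefficients of products of [Bcoef] with [G], and k is
    the exponent of xz. As all exponents of [m] are below N, truncation loses nothing. *)
Lemma Z1_mcoeff N (m : 'X_{1..3}) : (mdeg m < N)%N ->
  Z1 v m = (tsum N (fun d => G d *: x ^+ d) * tsum N (fun d => G d *: z ^+ d) *
    tsum N (fun d => H d *: (x * z) ^+ d) * tsum N (fun d => y ^+ d * Rsum d))@_m.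
Proof.
move=> mN; have m_lt i : (m i < N)%N.
  by rewrite (leq_ltn_trans _ mN) // mdegE (bigD1 i) //= leq_addr.
have gE (X : A) : tsum N (fun d => G d *: X ^+ d) = horner_alg X (gpoly N).
  rewrite /gpoly poly_def raddf_sum; apply: eq_bigr => i _.
  by rewrite /= -mul_polyC rmorphM rmorphXn /= horner_algC horner_algX mulr_algl.
have BE (X : A) b mu : \sum_(i < b.+1) Bcoef v mu i *: X ^+ i = horner_alg X (Bpoly b mu).
  rewrite /Bpoly poly_def raddf_sum; apply: eq_bigr => i _.
  by rewrite /= -mul_polyC rmorphM rmorphXn /= horner_algC horner_algX mulr_algl.
have prodE k b : N_x (gpoly N) * N_z (gpoly N) * (H k *: (x * z) ^+ k) * (y ^+ b * Rsum b) =
    \sum_(mu <- partitions b) (H k * (-1) ^+ b) *: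
      (N_x ('X^k * (Bpoly b mu * gpoly N)) * y ^+ b *
       N_z ('X^k * (Bpoly b (transpose mu) * gpoly N))).
  rewrite /Rsum scaler_sumr !mulr_sumr; apply: eq_bigr => mu _.
  rewrite !BE !rmorphM !rmorphXn /= !horner_algX exprMn.
  rewrite -!mul_mpolyC mpolyCM; ring.
rewrite Z1_expand // !gE /tsum [X in (X * _)@_m]mulr_sumr mulr_suml raddf_sum /=.
pose S (k : nat) : K := H k * ((-1) ^+ m i1 * \sum_(mu <- partitions (m i1))
  (\sum_(i < (m i0 - k).+1) Bcoef v mu i * G (m i0 - k - i)%N) *
  (\sum_(j < (m i2 - k).+1) Bcoef v (transpose mu) j * G (m i2 - k - j)%N)).
rewrite (big_ord_widen N (fun k => if (k <= m i2)%N then S k else 0)) ?m_lt //.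
rewrite big_mkcond; apply: eq_bigr => k _ /=.
rewrite mulr_sumr raddf_sum /= (bigD1 (Ordinal (m_lt i1))) //= [X in _ + X]big1 ?addr0;
  last first.
  move=> b; rewrite -val_eqE /= => bm; rewrite prodE raddf_sum big1 //= => mu _.
  by rewrite mcoeffZ mcoeff_xyz (negPf bm) mulr0 mul0r mulr0.
rewrite prodE raddf_sum /=.
transitivity (\sum_(mu <- partitions (m i1)) H k * (-1) ^+ m i1 *
    (('X^k * (Bpoly (m i1) mu * gpoly N))`_(m i0) *
    ('X^k * (Bpoly (m i1) (transpose mu) * gpoly N))`_(m i2))); last first.
  by apply: eq_bigr => mu _; rewrite mcoeffZ mcoeff_xyz eqxx mulr1.
rewrite ltnS; case: leqP => ka; last first.
  rewrite big_seq big1 // => mu mub.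
  by rewrite (coef_XGB _ (m_lt i0) mub) leqNgt ka mul0r mulr0.
case: leqP => kc; last first.
  rewrite big_seq big1 // => mu mub.
  by rewrite (coef_XGB _ (m_lt i2) (transpose_partitions mub)) leqNgt kc !mulr0.
rewrite /S mulrA mulr_sumr; apply: eq_big_seq => mu mub.
rewrite (coef_XGB _ (m_lt i0) mub) (coef_XGB _ (m_lt i2) (transpose_partitions mub)).
by rewrite ka kc -!mulrA.
Qed.

Lemma hs_monomial (X : A) (g : nat -> K) d :
  hs (fun n => X ^+ n * (g n)%:MP) d = hs g d *: X ^+ d.
Proof.
rewrite (hs_scale natM) -mul_mpolyC mulrC; congr (_ * _).
by apply/esym; apply: (newton_uniq natM (newton_morph (@mpolyC 3 K) (newton_hs natU g))
  (newton_hs natM _) (n := d)).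
Qed.

(** The exponent splits into the parts x, z, xz and y(1 - x)(1 - z); by [hsD] its exponential is the
    convolution of four sequences, which match the four factors of [Z1_mcoeff]. *)
Theorem Z1_series_exp (m : 'X_{1..3}) : Z1 v m = series_exp (Qseries v) m.
Proof.
have mN := ltnSn (mdeg m); set N := (mdeg m).+1 in mN.
rewrite (series_exp_Qseries natK v mN) (Z1_mcoeff mN).
pose px n := x ^+ n * (- w n ^+ 2)%:MP; pose pz n := z ^+ n * (- w n ^+ 2)%:MP.
pose pxz n := (x * z) ^+ n * (w n ^+ 2)%:MP; pose py n := y ^+ n * Rps n.
have QE n : Qps v n = px n + pz n + pxz n + py n.
  rewrite /Qps /px /pz /pxz /py /Rps /Qpoly -!mul_mpolyC mpolyCN exprMn; ring.
have ox d : ordge d (hs px d) by rewrite hs_monomial; apply: ordgeZ; exact: ordgeX.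
have oz d : ordge d (hs pz d) by rewrite hs_monomial; apply: ordgeZ; exact: ordgeX.
have oxz d : ordge d (hs pxz d).
  rewrite hs_monomial exprMn; apply: ordgeZ; apply: (ordgeW (leq_addr d d)).
  by apply: ordgeM; exact: ordgeX.
have oy d : ordge d (hs py d).
  rewrite (hs_scale natM) -[d in ordge d]addn0; apply: ordgeM; first exact: ordgeX.
  by [].
have hsE : hs (Qps v) =1 conv (conv (conv (hs px) (hs pz)) (hs pxz)) (hs py).
  move=> d; rewrite (eq_hs natM (p' := fun n => px n + pz n + pxz n + py n) (n := d)) //.
  rewrite (hsD natM (fun n => px n + pz n + pxz n)); apply: eq_conv => // i _.
  rewrite (hsD natM (fun n => px n + pz n)); apply: eq_conv => // j _.
  exact: hsD.
have tsum_eq f g : f =1 g -> tsum N f = tsum N g :> A.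
  by move=> fg; apply: eq_bigr => i _; exact: fg.
rewrite (tsum_eq _ _ hsE).
rewrite (tsum_eq (fun d => G d *: x ^+ d) (hs px)) => [|d]; last by rewrite hs_monomial.
rewrite (tsum_eq (fun d => G d *: z ^+ d) (hs pz)) => [|d]; last by rewrite hs_monomial.
rewrite (tsum_eq (fun d => H d *: (x * z) ^+ d) (hs pxz)) => [|d]; last by rewrite hs_monomial.
rewrite (tsum_eq (fun d => y ^+ d * Rsum d) (hs py)) => [|d];
  last by rewrite (hs_scale natM) Rsum_hs.
have oxz1 := ordge_conv ox oz; have oxz2 := ordge_conv oxz1 oxz.
have e1 := tsum_conv (N := N) ox oz; have e2 := tsum_conv (N := N) oxz1 oxz.
have e3 := tsum_conv (N := N) oxz2 oy.
rewrite -(e3 m mN); apply: eqmodM (mN) => // m' mN'.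
by rewrite -(e2 m' mN'); apply: eqmodM (mN').
Qed.

End FinalAssembly.

Lemma cexp_neq0 (R : realType) (u : R[i]) : cexp u != 0.
Proof.
apply/eqP => /eqP; rewrite eq_complex /= !mulf_eq0 !(gt_eqF (expR_gt0 _)) /= =>
  /andP[/eqP c0 /eqP s0].
by have := cos2Dsin2 (complex.Im u); rewrite c0 s0 expr0n addr0 => /eqP;
  rewrite eq_sym oner_eq0.
Qed.

(** Since [n] = v^(-n) (q^n - 1), the hypothesis on [lambda] says that all [n] with n >= 1 are
    nonzero, so that the specialization p_n = 1/[n] and the exponent are genuine fractions. *)
Theorem proposition19 (R : realType) (lambda : R[i])
    (q_not_root_of_unity : forall n : nat, (0 < n)%N -> qval lambda ^+ n != 1) :
  forall m : 'X_{1..3},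
    Z1 (qhalf lambda) m = series_exp (Qseries (qhalf lambda)) m.
Proof.
have v0 : qhalf lambda != 0 by exact: cexp_neq0.
apply: Z1_series_exp => // k; rewrite /qnum subr_eq0; apply/eqP => e.
have /eqP[] := q_not_root_of_unity k.+1 isT.
by rewrite -qhalf_sqr exprAC expr2 {1}e mulVf // expf_neq0.
Qed.
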